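(* Let $u$ be a weak solution of the equation $$u_t+u_x+6uu_x-6u^2u_x+12u^3u_x+u_{xxx}-u_{xxt}+14uu_{xxx}+28u_xu_{xx}=0,\qquad t>0,\ x\in\mathbb{R},$$ with initial data such that the equation is locally well-posed. If $u$ is $x$-symmetric, then $u$ is a traveling wave solution.
   Context: The equation is a model for surface waves of moderate amplitude in shallow water. Here $\mathbb{R}_+=(0,\infty)$ is the time half-line for test functions and for the axis of symmetry; $u$ is taken continuous up to $t=0$, with initial data $u(0,\cdot)$. The equation is written in the weak non-local form $$u_t-\partial_x(u+7u^2)+\partial_x(1-\partial_x^2)^{-1}R(u)=0,\qquad x\in\mathbb{R},\ t>0,$$ where $R(u):=2u+10u^2-2u^3+3u^4-7u_x^2$ and $(1-\partial_x^2)^{-1}f=\tfrac12 e^{-|x|}*f$ (convolution in $x$ on $\mathbb{R}$). **Weak solution.** A function $u(t,x)$ is a weak solution of the equation if $u\in C(\mathbb{R}_+,H^1(\mathbb{R}))$ satisfies $$\iint_{\mathbb{R}_+\times\mathbb{R}} u\,\phi_t-(u+7u^2)\,\phi_x+\big((1-\partial_x^2)^{-1}R(u)\big)\,\phi_x\,dt\,dx=0$$ for all $\phi\in C_0^\infty(\mathbb{R}_+\times\mathbb{R})$ (smooth functions with compact support). **$x$-symmetric.** A solution $u$ is $x$-symmetric if there exists a function $\lambda\in C^1(\mathbb{R}_+)$ such that for every $t>0$, $u(t,x)=u(t,2\lambda(t)-x)$ for a.e. $x\in\mathbb{R}$. The function $\lambda(t)$ is called the axis of symmetry. **Locally well-posed.**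 This is meant in the usual sense for the Cauchy problem associated to the equation; the hypothesis does not fix a particular space of initial data. For example, the Cauchy problem is known to be locally well-posed in $H^s(\mathbb{R})$ for $s>3/2$. **Traveling wave solution.** A solution of the form $u(t,x)=U(x-ct)$ for some constant $c\in\mathbb{R}$ and some profile $U\in H^1(\mathbb{R})$. *)

(* Defs.v *)
From HB Require Import structures.
From mathcomp Require Import all_boot all_order all_algebra.
From mathcomp Require Import all_classical all_reals all_analysis.

Set Implicit Arguments.
Unset Strict Implicit.
Unset Printing Implicit Defensive.

Import Order.TTheory GRing.Theory Num.Theory.
Import numFieldNormedType.Exports.

Local Open Scope classical_set_scope.
Local Open Scope ring_scope.

(** Used with [V] finite-dimensional ([R] or [R * R]), where having continuous
    iterated directional derivatives of all orders is being smooth. *)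
Fixpoint Ck (R : realType) (V : normedModType R) (k : nat) (f : V -> R) : Prop :=
  continuous f /\
  if k is k'.+1 then
    forall v : V, (forall x, derivable f x v) /\ Ck k' ('D_v f)
  else True.

Definition test_function (R : realType) (V : normedModType R) (O : set V)
    (f : V -> R) : Prop :=
  [/\ forall k, Ck k f,
      compact (closure [set x | f x != 0])
    & closure [set x | f x != 0] `<=` O].

Section Sobolev.
Variable R : realType.
Notation mu := (@lebesgue_measure R).

Definition L2 (f : R -> R) : Prop := f \in Lfun mu 2%:E.

Definition weak_derivative (f g : R -> R) : Prop :=
  forall psi : R -> R, test_function (V := R^o) setT psi ->
    \int[mu]_x (f x * psi^`()%classic x) = - \int[mu]_x (g x * psi x).

(** Functions stand for their almost-everywhere classes. *)
Definition H1 (f : R -> R) : Prop :=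
  L2 f /\ exists g, L2 g /\ weak_derivative f g.

(** For [f] in H^1 this is a representative of the weak derivative, which is
    unique up to null sets. *)
Definition wderiv (f : R -> R) : R -> R :=
  xget (cst 0) [set g | L2 g /\ weak_derivative f g].

Definition H1norm (f : R -> R) : R :=
  Num.sqrt (\int[mu]_x (f x ^+ 2) + \int[mu]_x (wderiv f x ^+ 2)).

(** The time interval [0, T), with [T = +oo] allowed. *)
Definition times (T : \bar R) : set R := [set t | 0 <= t /\ (t%:E < T)%E].

(** u belongs to C([0, T), H^1(R)). *)
Definition H1_curve (T : \bar R) (u : R -> R -> R) : Prop :=
  (forall t, times T t -> H1 (u t)) /\
  (forall t, times T t ->
     H1norm (u s \- u t) @[s --> within (times T) (nbhs t)] --> 0).

Definition helmholtz_inv (f : R -> R) (x : R) : R :=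
  2^-1 * \int[mu]_y (expR (- `|x - y|) * f y).

Definition nonlin (f : R -> R) (x : R) : R :=
  2 * f x + 10 * f x ^+ 2 - 2 * f x ^+ 3 + 3 * f x ^+ 4 - 7 * wderiv f x ^+ 2.

(** Weak solutions on (0, T) of
      u_t + u_x + 6 u u_x - 6 u^2 u_x + 12 u^3 u_x + u_xxx - u_xxt
        + 14 u u_xxx + 28 u_x u_xx = 0,
    obtained by applying (1 - d_x^2)^-1 to the equation and testing
      u_t - d_x (u + 7 u^2) + d_x (1 - d_x^2)^-1 (nonlin u) = 0
    against [phi]; points of the plane are pairs (t, x).  The space-time
    integral is iterated, space first, since [u t] is only given up to a null
    set for each [t], which leaves joint measurability undetermined. *)
Definition weak_solution (T : \bar R) (u : R -> R -> R) : Prop :=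
  H1_curve T u /\
  forall phi : R^o * R^o -> R,
    test_function [set p : R^o * R^o | 0 < p.1 /\ (p.1%:E < T)%E] phi ->
    \int[mu]_(t in [set t | 0 < t /\ (t%:E < T)%E])
      (\int[mu]_x (u t x * 'D_(1, 0) phi (t, x)
                   - (u t x + 7 * u t x ^+ 2) * 'D_(0, 1) phi (t, x)
                   + helmholtz_inv (nonlin (u t)) x * 'D_(0, 1) phi (t, x)))
    = 0.

Definition x_symmetric (u : R -> R -> R) : Prop :=
  exists lambda : R -> R,
    (forall t, 0 < t ->
       derivable lambda t 1 /\ {for t, continuous lambda^`()%classic}) /\
    (forall t, 0 < t -> {ae mu, forall x, u t x = u t (2 * lambda t - x)}).

Definition traveling_wave (u : R -> R -> R) : Prop :=
  exists (c : R) (U : R -> R), H1 U /\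
    forall t, 0 <= t -> {ae mu, forall x, u t x = U (x - c * t)}.

(** A Banach space [X] of initial data, continuously embedded in H^1(R) by [J],
    which picks a representative of each element (for instance H^s(R), s > 3/2,
    with continuous representatives). *)
Definition H1_embedding (X : completeNormedModType R)
    (J : {linear X -> (R -> R^o)}) : Prop :=
  [/\ forall a, H1 (J a),
      exists C : R, forall a, H1norm (J a) <= C * `|a|
    & forall a, {ae mu, forall x, J a x = 0} -> a = 0].

(** v in C([0, T), X) solves the Cauchy problem on [0, T) with v(0) = a. *)
Definition cauchy_solution (X : completeNormedModType R)
    (J : X -> R -> R) (T : R) (a : X) (v : R -> X) : Prop :=
  [/\ {within times T%:E, continuous v}, v 0 = a
    & weak_solution T%:E (fun t => J (v t))].

(** Around each datum there is a ball of data with a common existence time [T],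
    on which the solution exists, is unique in C([0, T), X), and depends
    continuously on the datum, uniformly in time. *)
Definition locally_well_posed (X : completeNormedModType R)
    (J : X -> R -> R) : Prop :=
  forall a0 : X, exists (T r : R) (S : X -> R -> X),
    [/\ 0 < T, 0 < r,
        forall a, ball a0 r a -> cauchy_solution J T a (S a),
        forall a v, ball a0 r a -> cauchy_solution J T a v ->
          forall t, times T%:E t -> v t = S a t
      & forall a, ball a0 r a -> forall e : R, 0 < e ->
          \forall b \near a, forall t, times T%:E t -> `|S b t - S a t| < e].

End Sobolev.

(* Main.v *)
Require Import Defs.
From HB Require Import structures.
From mathcomp Require Import all_boot all_order all_algebra.
From mathcomp Require Import all_classical all_reals all_analysis.
From mathcomp Require Import measurable_realfun ring lra.
Import Order.TTheory GRing.Theory Num.Theory.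
Import numFieldNormedType.Exports.
Local Open Scope classical_set_scope.
Local Open Scope ring_scope.

(** The equation reads u_t = d_x (flux u) with
    flux u = u + 7 u^2 - (1 - d_x^2)^-1 R(u). In the frame of the axis, the
    function w(t, x) = u(t, x + lambda(t)) is even in x and formally satisfies

      w_t = lambda'(t) w_x + d_x (flux w).

    The map flux commutes with the reflections and the translations of the line
    ([flux_isometry]), so flux w is even as well and the right-hand side is odd,
    whereas w_t is even: both sides vanish. Hence w does not depend on time
    ([symmetric_profile]), and lambda'(t) w_x = - d_x (flux w) with a fixed w
    ([profile_speed]). Therefore lambda' is constant, unless w_x = 0, and then
    w = 0 because w is square integrable ([affine_axis]). The identity
    u(t, x) = w(x - c t - b) extends to t = 0 by continuity in time
    ([profile_initial]), so u(0, .) is the profile of the wave.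

    The argument is carried out by duality. For a test function psi, the
    derivative of t |-> int u(t, x) psi(x - lambda(t)) dx is computed in
    [shifted_pairing_derive]; it rests on an estimate for the increments of
    int u(t, x) psi(x) dx ([pairing_increment]), obtained by testing the
    equation against rho(t) psi(x) with rho close to the indicator function of
    a time interval. The pairing of flux u with psi' is bounded locally
    uniformly in time, but is not known to be measurable in time;
    [Rint_sandwich] handles it, since the integral is monotone on all functions.

    These estimates rest on two facts about H^1, both proved with smooth steps
    and their derivatives, the bumps, whose pairings with a function converge at
    its Lebesgue points ([bump_cvg]). A square-integrable function is determined
    by its pairings with test functions ([L2_test_eq0]), which yields the
    uniqueness of weak derivatives; and a function of H^1 is bounded in terms of
    its norm ([ae_bound_H1]), hence so is its flux ([flux_le]). *)

Set Implicit Arguments.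
Unset Strict Implicit.
Unset Printing Implicit Defensive.

(** * Stability of iterated directional differentiability *)
Section CkClosure.
Variable R : realType.
Implicit Types V W : normedModType R.

Lemma Ck_continuous V k (f : V -> R) : Ck k f -> continuous f.
Proof. by case: k => [|k] []. Qed.

Lemma CkS V k (f : V -> R) : Ck k.+1 f -> Ck k f.
Proof.
elim: k f => [|k IH] f [cf df]; first by split.
by split=> // v; have [dfv /IH] := df v.
Qed.

Lemma Ck_cst V k (c : R) : Ck k (fun _ : V => c).
Proof.
elim: k c => [|k IH] c; split => //; try exact: cst_continuous.
move=> v; split; first by move=> x; exact: derivable_cst.
have -> : 'D_v (fun _ : V => c) = fun=> 0 by apply/funext => x; rewrite derive_cst.
exact: IH.
Qed.

Lemma CkD V k (f g : V -> R) : Ck k f -> Ck k g -> Ck k (fun x => f x + g x).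
Proof.
elim: k f g => [|k IH] f g [cf df] [cg dg]; split => //;
  try by move=> x; apply: cvgD; [exact: cf|exact: cg].
move=> v; have [dfv kf] := df v; have [dgv kg] := dg v.
split; first by move=> x; apply: derivableD.
have -> : 'D_v (fun x => f x + g x) = fun x => 'D_v f x + 'D_v g x.
  by apply/funext => x; rewrite -deriveD.
exact: IH.
Qed.

Lemma CkM V k (f g : V -> R) : Ck k f -> Ck k g -> Ck k (fun x => f x * g x).
Proof.
elim: k f g => [|k IH] f g hf hg; have cf := Ck_continuous hf;
  have cg := Ck_continuous hg; split => //;
  try by move=> x; apply: cvgM; [exact: cf|exact: cg].
move=> v; have [dfv kf] := hf.2 v; have [dgv kg] := hg.2 v.
split; first by move=> x; apply: derivableM.
have -> : 'D_v (fun x => f x * g x) = fun x => f x * 'D_v g x + g x * 'D_v f x.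
  by apply/funext => x; rewrite [LHS]deriveM.
by apply: CkD; apply: IH => //; exact: CkS.
Qed.

Lemma CkZ V k (c : R) (f : V -> R) : Ck k f -> Ck k (fun x => c * f x).
Proof. by move=> kf; apply: CkM => //; exact: Ck_cst. Qed.

Lemma CkV V k (f : V -> R) : (forall x, f x != 0) -> Ck k f ->
  Ck k (fun x => (f x)^-1).
Proof.
move=> f0; elim: k f f0 => [|k IH] f f0 hf; have cf := Ck_continuous hf;
  split => //; try by move=> x; apply: cvgV; [exact: f0|exact: cf].
move=> v; have [dfv kf] := hf.2 v.
split; first by move=> x; apply: derivableV.
have -> : 'D_v (fun x => (f x)^-1) = fun x => - 1 * ((f x)^-1 * (f x)^-1 * 'D_v f x).
  apply/funext => x; rewrite [LHS]deriveV// mulN1r scaleNr; congr (- (_ * _)).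
  by rewrite -exprVn expr2.
by apply: CkZ; apply: CkM => //; apply: CkM; apply: IH => //; exact: CkS.
Qed.

(** The growth rate of [f \o A] at [x] along [v] is literally that of [f] at
    [A x] along [L v], so no chain rule is involved; this covers translations,
    dilations and the two projections of the plane. *)
Lemma Ck_affine V W k (A L : V -> W) (f : W -> R) : continuous A ->
  (forall x h v, A (h *: v + x) = h *: L v + A x) ->
  Ck k f -> Ck k (f \o A).
Proof.
move=> cA AL; elim: k f => [|k IH] f hf; have cf := Ck_continuous hf;
  split => //; try by move=> x; apply: continuous_comp; [exact: cA|exact: cf].
move=> v; have [dfv kf] := hf.2 (L v).
have E x : (fun h => h^-1 *: ((f \o A \o shift x) (h *: v) - (f \o A) x)) =
           (fun h => h^-1 *: ((f \o shift (A x)) (h *: L v) - f (A x))).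
  by apply/funext => h /=; rewrite AL.
split; first by move=> x; rewrite /derivable E; exact: dfv.
have -> : 'D_v (f \o A) = 'D_(L v) f \o A.
  by apply/funext => x; rewrite /derive E.
exact: IH.
Qed.

Lemma derivable_direction (f : R -> R) x v : derivable f x 1 ->
  derivable (f : R^o -> R) x v /\ 'D_v (f : R^o -> R) x = v * f^`()%classic x.
Proof.
move=> df; have dff : differentiable f x by exact/derivable1_diffP.
split; first exact: diff_derivable.
by rewrite deriveE// deriv1E.
Qed.

(** On the line the derivative along [v] is [v] times the ordinary derivative,
    so the latter alone controls all the directions. *)
Lemma Ck_derive1 k (f : R -> R) : (forall x, derivable f x 1) ->
  Ck k (f^`()%classic : R^o -> R) -> Ck k.+1 (f : R^o -> R).
Proof.
move=> df kf; split.
  by move=> x; apply: differentiable_continuous; exact/derivable1_diffP.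
move=> v; split; first by move=> x; have [] := derivable_direction v (df x).
have -> : 'D_v (f : R^o -> R) = fun x => v * f^`()%classic x.
  by apply/funext => x; have [_ ->] := derivable_direction v (df x).
exact: CkZ.
Qed.

Lemma Ck_derivative k (f : R -> R) : Ck k.+1 (f : R^o -> R) ->
  Ck k (f^`()%classic : R^o -> R).
Proof.
move=> [_ /(_ 1)[_]]; rewrite (_ : 'D_1 (f : R^o -> R) = f^`()%classic)//.
by apply/funext => x; rewrite derive1E.
Qed.

End CkClosure.

(** * A quadratic criterion for differentiability *)
Section Quad.
Variable R : realType.

Lemma is_derive_quadratic (f : R -> R) x l C :
  (\forall y \near x, `|f y - f x - l * (y - x)| <= C * (y - x) ^+ 2) ->
  is_derive x 1 f l.
Proof.
move=> fC.
suff H : h^-1 *: ((f \o shift x) (h *: 1) - f x) @[h --> 0^'] --> l.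
  split; first by apply/cvg_ex; exists l.
  exact: (cvg_lim _ H).
apply/cvgrPdist_le => e e0.
have C1 : 0 < `|C| + 1 by rewrite ltr_wpDl.
have : \forall h \near (0 : R), `|f (h + x) - f x - l * h| <= C * h ^+ 2.
  have : \forall h \near (0 : R),
      (fun y => `|f y - f x - l * (y - x)| <= C * (y - x) ^+ 2) (h + x).
    have : (h + x) @[h --> (0 : R)] --> x.
      by rewrite -[X in _ --> X]add0r; apply: cvgD; [exact: cvg_id|exact: cvg_cst].
    by move=> H; exact: (H _ fC).
  by apply: filterS => h; rewrite addrK.
move=> near0; near=> h.
have h0 : h != 0 by near: h; exact: nbhs_dnbhs_neq.
have H : `|f (h + x) - f x - l * h| <= C * h ^+ 2.
  by near: h; apply: cvg_within; exact: near0.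
rewrite /= /GRing.scale /= mulr1.
have -> : l - h^-1 * (f (h + x) - f x) = - h^-1 * (f (h + x) - f x - l * h) by field.
rewrite normrM normrN normfV ler_pdivrMl ?normr_gt0//.
apply: (le_trans H).
have he : `|h| <= e / (`|C| + 1).
  near: h; apply: dnbhs0_le; exact: divr_gt0.
have -> : h ^+ 2 = `|h| * `|h| by rewrite -expr2 real_normK// num_real.
apply: (@le_trans _ _ ((`|C| + 1) * (`|h| * `|h|))).
  apply: ler_wpM2r; first exact: mulr_ge0.
  by rewrite (le_trans (ler_norm _))// lerDl.
by rewrite mulrCA; apply: ler_wpM2l => //; rewrite mulrC -ler_pdivlMr.
Unshelve. all: by end_near. Qed.

End Quad.

(** * A smooth step *)
Section SmoothStep.
Variable R : realType.

(** The functions x^-n exp(-1/x), extended by 0: the derivative of one of them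
    is a combination of two others, so they are all smooth at once. *)
Definition flat n (x : R) : R := if 0 < x then x^-1 ^+ n * expR (- x^-1) else 0.

(** exp(y) >= y^(n+2) / (n+2)! at y = 1/x; this gives both continuity and a
    zero derivative at the origin. *)
Lemma flat_quadratic n (x : R) : `|flat n x| <= (n.+2)`!%:R * x ^+ 2.
Proof.
rewrite /flat; case: ifPn => x0; last by rewrite normr0 mulr_ge0// sqr_ge0.
set y := x^-1; have y0 : 0 < y by rewrite invr_gt0.
rewrite ger0_norm; last by rewrite mulr_ge0 ?expR_ge0// exprn_ge0// ltW.
have := expR_ge1Dxn n.+1 (ltW y0).
have f0 : 0 < (n.+2)`!%:R :> R by rewrite ltr0n fact_gt0.
have -> : x = y^-1 by rewrite invrK.
clearbody y.
rewrite expRN ler_pdivrMr ?expR_gt0// => H.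
have {}H : y ^+ n.+2 / (n.+2)`!%:R <= expR y by apply: le_trans H; rewrite lerDr.
rewrite exprVn mulrAC ler_pdivlMr ?exprn_gt0// -exprD addn2.
by rewrite mulrC -ler_pdivrMr.
Qed.

Lemma is_derive_flat n (x : R) :
  is_derive x 1 (flat n) (flat n.+2 x - n%:R * flat n.+1 x).
Proof.
have [x0|x0|->] := ltrgtP x 0.
- rewrite /flat ltNge (ltW x0) /= mulr0 subr0.
  apply: (@near_eq_is_derive _ _ _ (cst 0)).
  near=> y; rewrite /= ifF//; apply/negbTE; rewrite -leNgt; apply/ltW.
  by near: y; exact: lt_nbhsl.
- rewrite /flat x0.
  have xn0 : x != 0 by rewrite gt_eqF.
  have dV : is_derive x 1 (fun y : R => y^-1) (- x^-1 ^+ 2).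
    have H := @is_deriveV _ id x 1 1 xn0 (is_derive_id x 1).
    by apply: (is_derive_eq H); rewrite /GRing.scale/= mulr1 exprVn.
  have dN : is_derive x 1 (fun y : R => - y^-1) (x^-1 ^+ 2).
    by apply: (is_derive_eq (is_deriveN dV)); rewrite opprK.
  have dE : is_derive x 1 (fun y : R => expR (- y^-1)) (x^-1 ^+ 2 * expR (- x^-1)).
    have H := @is_derive1_comp _ expR (fun y => - y^-1) _ _ _ (is_derive_expR (- x^-1)) dN.
    by apply: (is_derive_eq H); rewrite mulrC.
  have dX : is_derive x 1 (fun y : R => y^-1 ^+ n) (- n%:R * x^-1 ^+ n.+1).
    case: (n) => [|m].
      rewrite mulNr mul0r oppr0.
      have -> : (fun y : R => y^-1 ^+ 0) = cst 1 by apply/funext => y; rewrite expr0.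
      exact: is_derive_cst.
    have H := is_deriveX m.+1 dV. rewrite exprfctE in H; apply: (is_derive_eq H).
    by rewrite /GRing.scale/= !exprS; ring.
  have dF := @is_deriveM _ _ _ _ _ _ _ _ dX dE; rewrite mulrfctE in dF.
  apply: is_derive_eq; first apply: (near_eq_is_derive _ dF).
    near=> y; rewrite ifT//.
    by near: y; exact: lt_nbhsr.
  by rewrite /GRing.scale/= !exprS; ring.
- have fl0 k : flat k 0 = 0 by rewrite /flat ltxx.
  rewrite !fl0 mulr0 subr0.
  apply: (@is_derive_quadratic _ _ _ _ (n.+2)`!%:R); near=> y.
  rewrite fl0 !subr0 mul0r subr0; exact: flat_quadratic.
Unshelve. all: by end_near. Qed.

Lemma flat_smooth k n : Ck k (flat n : R^o -> R).
Proof.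
elim: k n => [|k IH] n.
  split => // x; apply: differentiable_continuous; apply/derivable1_diffP.
  by have [] := is_derive_flat n x.
apply: Ck_derive1; first by move=> x; have [] := is_derive_flat n x.
have -> : (flat n)^`()%classic = fun x => flat n.+2 x + (- n%:R) * flat n.+1 x.
  by apply/funext => x; rewrite derive1E; have [_ ->] := is_derive_flat n x; rewrite mulNr.
by apply: CkD => //; exact: CkZ.
Qed.

Lemma flat_ge0 n x : 0 <= flat n x.
Proof.
rewrite /flat; case: ifPn => // x0.
by rewrite mulr_ge0 ?expR_ge0// exprn_ge0// invr_ge0 ltW.
Qed.

Lemma flat_gt0 n x : 0 < x -> 0 < flat n x.
Proof.
by move=> x0; rewrite /flat x0 mulr_gt0 ?expR_gt0// exprn_gt0// invr_gt0.
Qed.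

Lemma flat_le0 n x : x <= 0 -> flat n x = 0.
Proof. by move=> x0; rewrite /flat ltNge x0. Qed.

(** The quotient of flat functions that is 0 up to -1 and 1 from 1 on. *)
Definition sstep (x : R) : R := flat 0 (1 + x) / (flat 0 (1 + x) + flat 0 (1 - x)).

Let den_gt0 x : 0 < flat 0 (1 + x) + flat 0 (1 - x).
Proof.
have [x0|x0] := leP 0 x.
  by apply: ltr_pwDl; [apply: flat_gt0; rewrite ltr_pwDl|exact: flat_ge0].
by apply: ltr_wpDl; [exact: flat_ge0|apply: flat_gt0; rewrite subr_gt0 (lt_trans x0)].
Qed.

Lemma sstep_smooth k : Ck k (sstep : R^o -> R).
Proof.
have cD (a b : R) : continuous (fun x : R^o => (a + b * x : R^o)).
  move=> x; apply: cvgD; first exact: cvg_cst.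
  by apply: cvgM; [exact: cvg_cst|exact: cvg_id].
have H (b : R) : Ck k (fun x : R^o => flat 0 (1 + b * x)).
  apply: (@Ck_affine _ _ _ _ (fun x : R^o => (1 + b * x : R^o)) (fun v => b * v) (flat 0)).
  - exact: cD.
  - by move=> x h v; rewrite /GRing.scale/=; ring.
  - exact: flat_smooth.
have H1 : Ck k (fun x : R^o => flat 0 (1 + x)).
  by have := H 1; under eq_fun do rewrite mul1r.
have H2 : Ck k (fun x : R^o => flat 0 (1 - x)).
  by have := H (- 1); under eq_fun do rewrite mulN1r.
apply: CkM => //; apply: CkV; first by move=> x; rewrite gt_eqF.
exact: CkD.
Qed.

Lemma sstep_ge0 x : 0 <= sstep x.
Proof. by rewrite /sstep divr_ge0 ?flat_ge0// ltW. Qed.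

Lemma sstep_le1 x : sstep x <= 1.
Proof. by rewrite /sstep ler_pdivrMr// mul1r lerDl flat_ge0. Qed.

Lemma sstep_eq0 x : x <= - 1 -> sstep x = 0.
Proof. by move=> x1; rewrite /sstep flat_le0 ?mul0r//; lra. Qed.

Lemma sstep_eq1 x : 1 <= x -> sstep x = 1.
Proof.
move=> x1; have := den_gt0 x; rewrite /sstep (@flat_le0 0 (1 - x)); last by lra.
by rewrite addr0 => ?; rewrite divff// gt_eqF.
Qed.

End SmoothStep.

(** * Test functions on the line *)
Section TestFunctions.
Variable R : realType.
Implicit Types f g psi : R -> R.

(** Test functions on the line, with the compactness of the support replaced by
    an explicit radius; see [test_functionP]. *)
Definition smooth_cpt f : Prop :=
  (forall k, Ck k (f : R^o -> R)) /\ exists L, forall x, L < `|x| -> f x = 0.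

Lemma smooth_cpt_radius f : smooth_cpt f ->
  exists L, 0 < L /\ forall x, L <= `|x| -> f x = 0.
Proof.
move=> [_ [L fL]]; exists (`|L| + 1); split; first by rewrite ltr_wpDl.
move=> x Lx; apply: fL; apply: lt_le_trans Lx.
by rewrite (le_lt_trans (ler_norm L))// ltrDl.
Qed.

Lemma closure_support_itv (f : R -> R) L : (forall x, L < `|x| -> f x = 0) ->
  closure [set x : R^o | f x != 0] `<=` `[- L, L]%classic.
Proof.
move=> fL; have /closure_id -> : closed (`[- L, L]%classic : set R^o).
  exact: interval_closed.
apply: closureS => x /= fx; rewrite in_itv/= -ler_norml leNgt.
by apply/negP => /fL fx0; rewrite fx0 eqxx in fx.
Qed.

Lemma test_functionP f : test_function (V := R^o) setT f <-> smooth_cpt f.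
Proof.
split=> [[kf cf _]|[kf [L fL]]].
  split => //; have := compact_bounded cf => -[M [_ HM]].
  exists (`|M| + 1) => x Mx; apply/eqP/negPn/negP => fx0.
  have MM : M < `|M| + 1 by rewrite (le_lt_trans (ler_norm M)) ?ltrDl.
  have cx : closure [set y : R^o | f y != 0] x by exact: subset_closure.
  by have /= := HM _ MM _ cx; rewrite leNgt Mx.
split => //.
apply: (@subclosed_compact _ _ (`[- L, L]%classic : set R^o)).
- exact: closed_closure.
- exact: segment_compact.
- exact: closure_support_itv.
Qed.

Lemma smooth_cpt_derivable f : smooth_cpt f -> forall x, derivable f x 1.
Proof. by move=> [kf _] x; have [_ /(_ 1)[]] := kf 1%N. Qed.

Lemma smooth_cpt_continuous f : smooth_cpt f -> continuous f.
Proof. by move=> [/(_ 0%N)[]]. Qed.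

Lemma smooth_cpt_derive f : smooth_cpt f -> smooth_cpt f^`()%classic.
Proof.
move=> [kf [L fL]]; split; first by move=> k; exact: Ck_derivative.
exists L => x Lx; rewrite derive1E -(@derive_cst _ R^o R^o 0 x 1).
apply: near_eq_derive; near=> y; apply: fL.
near: y; have := @norm_continuous _ R^o x => /cvgr_gt; exact.
Unshelve. all: by end_near. Qed.

Lemma smooth_cpt_affine f (a b : R) : a != 0 -> smooth_cpt f ->
  smooth_cpt (fun x => f (a * x + b)).
Proof.
move=> a0 [kf [L fL]]; split.
  move=> k; apply: (@Ck_affine _ _ _ _
    (fun x : R^o => (a * x + b : R^o)) (fun v => a * v) f) => //.
    move=> x; apply: cvgD; last exact: cvg_cst.
    by apply: cvgM; [exact: cvg_cst|exact: cvg_id].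
  by move=> x h v; rewrite /GRing.scale/=; ring.
exists ((L + `|b|) / `|a|) => x; rewrite ltr_pdivrMr ?normr_gt0// => H.
apply: fL; rewrite mulrC -normrM in H.
have := ler_normB (a * x + b) b; rewrite addrK => H2.
by rewrite -(ltrD2r `|b|) (lt_le_trans H).
Qed.

Lemma smooth_cptD f g : smooth_cpt f -> smooth_cpt g -> smooth_cpt (fun x => f x + g x).
Proof.
move=> [kf [L fL]] [kg [M gM]]; split; first by move=> k; exact: CkD.
exists (Num.max L M) => x; rewrite gt_max => /andP[? ?].
by rewrite fL// gM// addr0.
Qed.

Lemma is_derive_affine (a b x : R) : is_derive x 1 (fun x => a * x + b) a.
Proof.
apply: (@is_derive_quadratic _ _ _ _ 0); near=> y.
by rewrite mul0r (_ : _ - _ - _ = 0) ?normr0//; ring.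
Unshelve. all: by end_near. Qed.

Lemma derive1_affine f (a b : R) x : derivable f (a * x + b) 1 ->
  (fun x => f (a * x + b))^`()%classic x = a * f^`()%classic (a * x + b).
Proof.
move=> df; rewrite !derive1E.
have dA := is_derive_affine a b x.
have H := @is_derive1_comp _ f (fun x => a * x + b) _ _ _ (derivableP df) dA.
by have [_ ->] := H; rewrite mulrC.
Qed.

Lemma smooth_cpt_bounded f : smooth_cpt f ->
  exists C, 0 < C /\ forall x, `|f x| <= C.
Proof.
move=> hf; have [L [L0 fL]] := smooth_cpt_radius hf.
have cf : {within `[- L, L], continuous (Num.norm \o f)}.
  apply: continuous_subspaceT => x; apply: continuous_comp.
    exact: smooth_cpt_continuous.
  exact: norm_continuous.
have [|c _ Hc] := EVT_max _ cf; first by lra.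
exists (`|f c| + 1); split; first by rewrite ltr_wpDl.
move=> x; have [Lx|xL] := leP L `|x|.
  by rewrite fL// normr0 addr_ge0.
apply: (@le_trans _ _ `|f c|); last by rewrite lerDl.
by apply: Hc; rewrite in_itv/= -ler_norml ltW.
Qed.

Lemma smooth_cpt_lipschitz f : smooth_cpt f ->
  exists C, 0 < C /\ forall x y, `|f y - f x| <= C * `|y - x|.
Proof.
move=> hf; have [C [C0 HC]] := smooth_cpt_bounded (smooth_cpt_derive hf).
exists C; split => // x y; wlog xy : x y / x <= y.
  move=> H; have [/H//|/ltW/H] := leP x y.
  by rewrite distrC (distrC x y).
have [c _ ->] : exists2 c, c \in `[x, y] & f y - f x = f^`()%classic c * (y - x).
  apply: MVT_segment => //.
    move=> z _; rewrite derive1E; apply: derivableP; exact: smooth_cpt_derivable.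
  by apply: continuous_subspaceT => z; exact: smooth_cpt_continuous.
by rewrite normrM ler_wpM2r.
Qed.

(** The second-order remainder is controlled by the Lipschitz constant of the
    derivative. *)
Lemma smooth_cpt_taylor f : smooth_cpt f ->
  exists C, 0 < C /\ forall x y,
    `|f y - f x - f^`()%classic x * (y - x)| <= C * (y - x) ^+ 2.
Proof.
move=> hf; have [C [C0 HC]] := smooth_cpt_lipschitz (smooth_cpt_derive hf).
exists C; split => // x y.
pose h z := f z - (f^`()%classic x * z + 0).
have dh (z : R) : is_derive z 1 h (f^`()%classic z - f^`()%classic x).
  have df : is_derive z 1 f (f^`()%classic z).
    by rewrite derive1E; apply: derivableP; exact: smooth_cpt_derivable.
  exact: is_deriveB df (is_derive_affine _ _ z).
have ch : continuous h.
  by move=> z; apply/differentiable_continuous/derivable1_diffP; have [] := dh z.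
have E : f y - f x - f^`()%classic x * (y - x) = h y - h x by rewrite /h; ring.
rewrite {}E -real_normK ?num_real// expr2 mulrA.
have K (a b : R) : a <= b -> exists2 c, `|h b - h a| <= C * `|c - x| * `|b - a| & a <= c <= b.
  move=> ab; have [c cab ->] : exists2 c, c \in `[a, b] &
      h b - h a = (f^`()%classic c - f^`()%classic x) * (b - a).
    by apply: MVT_segment => //; exact: continuous_subspaceT.
  by exists c => //; rewrite normrM ler_wpM2r.
have [xy|/ltW yx] := leP x y.
  have [c Hc /andP[xc cy]] := K _ _ xy.
  apply: (le_trans Hc); rewrite ler_wpM2r// ler_wpM2l ?(ltW C0)//.
  by rewrite !ger0_norm ?subr_ge0// lerD2r.
have [c Hc /andP[xc cy]] := K _ _ yx.
rewrite distrC; apply: (le_trans Hc); rewrite (distrC y x).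
rewrite ler_wpM2r// ler_wpM2l ?(ltW C0)//.
by rewrite (distrC c) !ger0_norm ?subr_ge0// lerD2l lerN2.
Qed.

Definition step (e x : R) (z : R) : R := sstep (e^-1 * z + - (x / e)).

(** As the derivative of a step, a bump has integral 1, and the difference of
    two bumps is the derivative of the test function [step e x - step e y],
    which approximates the indicator function of [x, y]. *)
Definition bump e x := (step e x)^`()%classic.

Lemma step_smooth e x k : Ck k (step e x : R^o -> R).
Proof.
apply: (@Ck_affine _ _ _ _
  (fun z : R^o => (e^-1 * z + - (x / e) : R^o)) (fun v => e^-1 * v) (@sstep R)).
- move=> z; apply: cvgD; last exact: cvg_cst.
  by apply: cvgM; [exact: cvg_cst|exact: cvg_id].
- by move=> z h v; rewrite /GRing.scale/=; ring.
- exact: sstep_smooth.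
Qed.

Lemma step_ge0 e x z : 0 <= step e x z. Proof. exact: sstep_ge0. Qed.
Lemma step_le1 e x z : step e x z <= 1. Proof. exact: sstep_le1. Qed.

Lemma step_eq0 e x z : 0 < e -> z <= x - e -> step e x z = 0.
Proof.
move=> e0 zx; apply: sstep_eq0.
by rewrite mulrC -mulrBl ler_pdivrMr//; lra.
Qed.

Lemma step_eq1 e x z : 0 < e -> x + e <= z -> step e x z = 1.
Proof.
move=> e0 zx; apply: sstep_eq1.
by rewrite mulrC -mulrBl ler_pdivlMr//; lra.
Qed.

Lemma derivable_step e x z : derivable (step e x) z 1.
Proof. by have [_ /(_ 1)[]] := step_smooth e x 1. Qed.

Lemma bump_eq0 e x z : 0 < e -> e < `|z - x| -> bump e x z = 0.
Proof.
move=> e0; rewrite /bump derive1E.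
have K c : (\forall y \near z, cst c y = step e x y) -> 'D_1 (step e x) z = 0.
  by move=> H; rewrite -(@derive_cst _ R^o R^o c z 1); apply/esym/near_eq_derive.
have [zx|/ltW zx] := leP 0 (z - x).
- rewrite ger0_norm// => ez.
  apply: (K 1); near=> y; rewrite /= step_eq1//.
  by apply/ltW; near: y; apply: lt_nbhsr; lra.
- rewrite ler0_norm// => ez.
  apply: (K 0); near=> y; rewrite /= step_eq0//.
  by apply/ltW; near: y; apply: lt_nbhsl; lra.
Unshelve. all: by end_near. Qed.

Lemma bump_smooth_cpt e x : 0 < e -> smooth_cpt (bump e x).
Proof.
move=> e0; split.
  by move=> k; apply: Ck_derivative; exact: step_smooth.
exists (e + `|x|) => z H; apply: bump_eq0 => //.
by rewrite (lt_le_trans _ (lerB_dist _ _))// ltrBrDr.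
Qed.

Lemma bump_bound : exists C : R, 0 < C /\ forall e x z, 0 < e -> `|bump e x z| <= C / e.
Proof.
have [C [C0 HC]] := smooth_cpt_bounded (bump_smooth_cpt 0 ltr01).
exists C; split => // e x z e0.
have E : step e x = fun z => step 1 0 (e^-1 * z + - (x / e)).
  by apply/funext => y; rewrite /step invr1 mul1r mul0r subr0.
rewrite /bump E derive1_affine; last exact: derivable_step.
by rewrite normrM mulrC [`|e^-1|]gtr0_norm ?invr_gt0// ler_pM2r ?invr_gt0//; exact: HC.
Qed.

Lemma step_sub_smooth_cpt e x y : 0 < e ->
  smooth_cpt (fun z => step e x z - step e y z).
Proof.
move=> e0; split.
  move=> k; under eq_fun do rewrite -[- _]mulN1r.
  apply: CkD; first exact: step_smooth.
  by apply: CkZ; exact: step_smooth.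
exists (`|x| + `|y| + e) => z; rewrite ltr_normr => /orP[] H.
- rewrite !step_eq1 ?subrr//.
  + by rewrite (le_trans _ (ltW H))// lerD2r (le_trans (ler_norm y))// lerDr.
  + by rewrite (le_trans _ (ltW H))// lerD2r (le_trans (ler_norm x))// lerDl.
- have := ler_norm (- x); have := ler_norm (- y); rewrite !normrN.
  have := normr_ge0 x; have := normr_ge0 y => ? ? ? ?.
  by rewrite !step_eq0 ?subrr//; lra.
Qed.

Lemma derive_step_sub e x y : (fun z => step e x z - step e y z)^`()%classic =
  fun z => bump e x z - bump e y z.
Proof.
apply/funext => z; rewrite /bump !derive1E deriveB//; exact: derivable_step.
Qed.

Lemma step_sub_le e x y z : `|step e x z - step e y z| <= 1.
Proof.
have := step_ge0 e x z; have := step_ge0 e y z; have := step_le1 e x z.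
have := step_le1 e y z; rewrite ler_norml; lra.
Qed.

Lemma step_sub_eq0 e x y z : 0 < e -> x <= y -> z <= x - e \/ y + e <= z ->
  step e x z - step e y z = 0.
Proof.
move=> e0 xy [H|H]; first by rewrite !step_eq0 ?subrr//; lra.
by rewrite !step_eq1 ?subrr//; lra.
Qed.

End TestFunctions.

(** * Test functions of product form on the plane *)
Section Tensor.
Variable R : realType.
Implicit Types rho psi : R -> R.

Lemma Ck_fst k rho : Ck k (rho : R^o -> R) -> Ck k (fun p : R^o * R^o => rho p.1).
Proof.
move=> kr; apply: (@Ck_affine _ _ _ _ (@fst R^o R^o) (@fst R^o R^o) (rho : R^o -> R)) => //.
by move=> p; exact: cvg_fst.
Qed.

Lemma Ck_snd k rho : Ck k (rho : R^o -> R) -> Ck k (fun p : R^o * R^o => rho p.2).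
Proof.
move=> kr; apply: (@Ck_affine _ _ _ _ (@snd R^o R^o) (@snd R^o R^o) (rho : R^o -> R)) => //.
by move=> p; exact: cvg_snd.
Qed.

(** Product test functions separate the two variables, which turns the weak
    formulation into an equation for functions of time. *)
Lemma derive_tensor rho psi (v : R^o * R^o) (t x : R) :
  smooth_cpt rho -> smooth_cpt psi ->
  'D_v (fun p : R^o * R^o => rho p.1 * psi p.2) (t, x) =
  v.1 * rho^`()%classic t * psi x + v.2 * rho t * psi^`()%classic x.
Proof.
move=> hr hp.
have [dr er] := derivable_direction v.1 (@smooth_cpt_derivable _ _ hr t).
have [dp ep] := derivable_direction v.2 (@smooth_cpt_derivable _ _ hp x).
have E1 : 'D_v (fun p : R^o * R^o => rho p.1) (t, x) = v.1 * rho^`()%classic t.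
  by rewrite -er.
have E2 : 'D_v (fun p : R^o * R^o => psi p.2) (t, x) = v.2 * psi^`()%classic x.
  by rewrite -ep.
have d1 : derivable (fun p : R^o * R^o => rho p.1) (t, x) v by exact: dr.
have d2 : derivable (fun p : R^o * R^o => psi p.2) (t, x) v by exact: dp.
apply: (etrans (deriveM d1 d2)); rewrite E1 E2.
by rewrite /GRing.scale/=; ring.
Qed.

Lemma test_function_tensor rho psi (a b : R) : 0 < a -> smooth_cpt rho ->
  (forall t, t < a \/ b < t -> rho t = 0) -> smooth_cpt psi ->
  test_function [set p : R^o * R^o | 0 < p.1 /\ (p.1%:E < +oo)%E]
    (fun p => rho p.1 * psi p.2).
Proof.
move=> a0 [kr _] r0 [kp [L pL]].
pose S := [set p : R^o * R^o | rho p.1 * psi p.2 != 0].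
have SB : closure S `<=` (`[a, b]%classic : set R^o) `*` (`[- L, L]%classic : set R^o).
  have /closure_id -> : closed ((`[a, b]%classic : set R^o) `*` (`[- L, L]%classic : set R^o)).
    have -> : (`[a, b]%classic : set R^o) `*` (`[- L, L]%classic : set R^o) =
        (@fst R^o R^o) @^-1` `[a, b]%classic `&` (@snd R^o R^o) @^-1` `[- L, L]%classic.
      by [].
    apply: closedI; apply: closed_comp; try exact: interval_closed.
      by move=> p _; exact: cvg_fst.
    by move=> p _; exact: cvg_snd.
  apply: closureS => -[t x] /=; rewrite /S/= mulf_eq0 negb_or => /andP[rt px].
  rewrite !in_itv/= -ler_norml; split.
    rewrite !leNgt; apply/andP; split; apply/negP => H.
      by rewrite r0 ?eqxx// in rt; left.
    by rewrite r0 ?eqxx// in rt; right.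
  by rewrite leNgt; apply/negP => /pL H; rewrite H eqxx in px.
split.
- by move=> k; apply: CkM; [exact: Ck_fst|exact: Ck_snd].
- apply: subclosed_compact SB; first exact: closed_closure.
  by apply: compact_setX; exact: segment_compact.
- move=> p /SB[]/=; rewrite in_itv/= => /andP[ap _] _; split.
    exact: lt_le_trans ap.
  exact: ltry.
Qed.

End Tensor.

(** * Real-valued integrals on the line *)
Section Integration.
Variable R : realType.
Notation mu := (@lebesgue_measure R).
Implicit Types f g h k : R -> R.

Lemma ae_mono (P Q : R -> Prop) : {ae mu, forall x, P x} ->
  (forall x, P x -> Q x) -> {ae mu, forall x, Q x}.
Proof. move=> HP PQ; have FF := @ae_filter_ringOfSetsType _ _ _ mu.
by apply: filterS HP; exact: PQ. Qed.

Lemma ae_mono2 (P1 P2 Q : R -> Prop) : {ae mu, forall x, P1 x} ->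
  {ae mu, forall x, P2 x} -> (forall x, P1 x -> P2 x -> Q x) ->
  {ae mu, forall x, Q x}.
Proof. move=> H1 H2 PQ; have FF := @ae_filter_ringOfSetsType _ _ _ mu.
by apply: filterS2 H1 H2; exact: PQ. Qed.

Definition integrableR f := mu.-integrable setT (EFin \o f).

Lemma integrableR_measurable f : integrableR f -> measurable_fun setT f.
Proof. by move=> /integrableP[/measurable_EFinP]. Qed.

Lemma integrableRD f g : integrableR f -> integrableR g -> integrableR (fun x => f x + g x).
Proof. by move=> hf hg; have := integrableD measurableT hf hg. Qed.

Lemma integrableRZ c f : integrableR f -> integrableR (fun x => c * f x).
Proof. by move=> hf; have := integrableZl measurableT c hf. Qed.

Lemma integrableRB f g : integrableR f -> integrableR g -> integrableR (fun x => f x - g x).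
Proof. by move=> hf hg; have := integrableB measurableT hf hg. Qed.

Lemma integrableR_norm f : integrableR f -> integrableR (fun x => `|f x|).
Proof. by move=> hf; have := integrable_norm hf. Qed.

Lemma integrableR_le f g : measurable_fun setT f -> integrableR g ->
  {ae mu, forall x, `|f x| <= g x} -> integrableR f.
Proof.
move=> mf hg fg; have mg := integrableR_measurable hg.
move: hg => /integrableR_norm/integrableP[_ hg].
apply/integrableP; split; first exact/measurable_EFinP.
apply: le_lt_trans hg; apply: ae_ge0_le_integral => //.
- by apply/measurable_EFinP; exact: measurableT_comp.
- by apply/measurable_EFinP; do 2 apply: measurableT_comp => //.
- apply: (ae_mono fg) => x fgx _; rewrite /= lee_fin normr_id (le_trans fgx)//.
  exact: ler_norm.
Qed.

Lemma RintD f g : integrableR f -> integrableR g ->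
  \int[mu]_x (f x + g x) = \int[mu]_x f x + \int[mu]_x g x.
Proof. by move=> hf hg; rewrite RintegralD. Qed.

Lemma RintB f g : integrableR f -> integrableR g ->
  \int[mu]_x (f x - g x) = \int[mu]_x f x - \int[mu]_x g x.
Proof. by move=> hf hg; rewrite RintegralB. Qed.

Lemma RintZ c f : integrableR f -> \int[mu]_x (c * f x) = c * \int[mu]_x f x.
Proof. by move=> hf; rewrite RintegralZl. Qed.

Lemma ae_eq_Rint f g : measurable_fun setT f -> measurable_fun setT g ->
  {ae mu, forall x, f x = g x} -> \int[mu]_x f x = \int[mu]_x g x.
Proof.
move=> mf mg fg; congr fine; apply: ae_eq_integral => //; try exact/measurable_EFinP.
by apply: (ae_mono fg) => x fgx _; rewrite fgx.
Qed.

Lemma ae_le_Rint f g : integrableR f -> integrableR g ->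
  {ae mu, forall x, f x <= g x} -> \int[mu]_x f x <= \int[mu]_x g x.
Proof.
move=> hf hg fg; rewrite -subr_ge0 -RintB//.
rewrite (@ae_eq_Rint (fun x => g x - f x) (fun x => `|g x - f x|)).
- by apply: Rintegral_ge0 => x _; exact: normr_ge0.
- exact: integrableR_measurable (integrableRB hg hf).
- exact: integrableR_measurable (integrableR_norm (integrableRB hg hf)).
- by apply: (ae_mono fg) => x fgx; rewrite ger0_norm ?subr_ge0.
Qed.

Lemma ae_normr_Rint_le f g : measurable_fun setT f -> integrableR g ->
  {ae mu, forall x, `|f x| <= g x} -> `|\int[mu]_x f x| <= \int[mu]_x g x.
Proof.
move=> mf hg fg; have hf := integrableR_le mf hg fg.
apply: le_trans (le_normr_Rintegral _ hf) _ => //.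
by apply: ae_le_Rint => //; exact: integrableR_norm.
Qed.

Lemma normr_Rint_le f g : measurable_fun setT f -> integrableR g ->
  (forall x, `|f x| <= g x) -> `|\int[mu]_x f x| <= \int[mu]_x g x.
Proof. by move=> mf hg fg; apply: ae_normr_Rint_le => //; exact: aeW. Qed.

(** The integral of a nonnegative function is a supremum over the simple
    functions below it, hence is monotone even on functions that are not
    measurable. *)
Lemma ge0_le_integral_nomeas (f g : R -> \bar R) : (forall x, (0 <= f x)%E) ->
  (forall x, (f x <= g x)%E) -> (\int[mu]_x f x <= \int[mu]_x g x)%E.
Proof.
move=> f0 fg; have g0 x : (0 <= g x)%E by exact: le_trans (fg x).
rewrite !ge0_integralTE//; apply: ereal_sup_le => _ [h /= hf <-].
by exists h => // x; exact: le_trans (fg x).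
Qed.

(** Here [e] may fail to be measurable: the weak formulation involves an
    integral over time of such a function, and only its distance to an
    integrable function is known. *)
Lemma Rint_sandwich (e f k : R -> R) : integrableR f -> integrableR k ->
  (forall x, `|e x - f x| <= k x) ->
  `|\int[mu]_x e x - \int[mu]_x f x| <= \int[mu]_x k x.
Proof.
move=> hf hk efk.
have mono (a b : R -> R) : (forall x, a x <= b x) ->
    (\int[mu]_x (a x)%:E <= \int[mu]_x (b x)%:E)%E.
  move=> ab; rewrite integralE [leRHS]integralE.
  apply: leeB; apply: ge0_le_integral_nomeas => // x.
    by apply: (funepos_le (D := setT)); rewrite ?inE// => y _; rewrite lee_fin.
  by apply: (funeneg_le (D := setT)); rewrite ?inE// => y _; rewrite lee_fin.
have hl := integrableRB hf hk; have hr := integrableRD hf hk.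
have le_e : (\int[mu]_x (f x - k x)%:E <= \int[mu]_x (e x)%:E)%E.
  by apply: mono => x; have := efk x; rewrite ler_norml; lra.
have e_le : (\int[mu]_x (e x)%:E <= \int[mu]_x (f x + k x)%:E)%E.
  by apply: mono => x; have := efk x; rewrite ler_norml; lra.
have fl := integrable_fin_num measurableT hl.
have fr := integrable_fin_num measurableT hr.
have fe : (\int[mu]_x (e x)%:E)%E \is a fin_num.
  move: le_e e_le fl fr; rewrite /comp/=.
  case: (\int[mu]_x (e x)%:E)%E => [//||].
    by move=> _; rewrite leye_eq => /eqP ->.
  by rewrite leeNy_eq => /eqP ->.
have := fine_le fl fe le_e; have := fine_le fe fr e_le.
rewrite -!/(Rintegral _ _ _) => H1 H2.
have := RintB hf hk; have := RintD hf hk; rewrite /Rintegral in H1 H2 *.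
rewrite ler_norml => E1 E2; rewrite E1 in H1; rewrite E2 in H2; lra.
Qed.

End Integration.

(** * Invariance of the integral under isometries of the line *)
Section Affine.
Variable R : realType.
Notation mu := (@lebesgue_measure R).
Implicit Types (f : R -> R) (s c : R).

Let iso (s c : R) : R -> measurableTypeR R := fun x => s * x + c.

Let miso s c : measurable_fun setT (iso s c).
Proof.
rewrite /iso; apply: (@measurable_funD _ _ _ _ (fun x : R => s * x) (fun=> c)).
  apply: (@measurable_funM _ _ _ _ (fun=> s) id); first exact: measurable_cst.
  exact: measurable_id.
exact: measurable_cst.
Qed.

Lemma lebesgue_measure_isometry s c (A : set R) : `|s| = 1 -> measurable A ->
  mu (iso s c @^-1` A) = mu A.
Proof.
move=> s1 mA.
suff H : mu A = pushforward mu (iso s c) A by exact: esym H.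
apply: lebesgue_measure_unique => [|mi _ [[a b] _ <-]|//] /=; first exact: miso.
rewrite /pushforward; have [s0|s0] := leP 0 s.
- have -> : s = 1 by rewrite -(ger0_norm s0).
  have -> : iso 1 c @^-1` `]a, b]%classic = `]a - c, b - c]%classic.
    apply/seteqP; split => x; rewrite /iso/= !in_itv/= mul1r;
      by move=> /andP[? ?]; apply/andP; split; lra.
  by rewrite !lebesgue_measure_itv/= !lte_fin ltrD2r -!EFinB;
    congr (if _ then _%:E else _); ring.
- have -> : s = -1 by rewrite -(opprK s) -(ltr0_norm s0) s1.
  have -> : iso (-1) c @^-1` `]a, b]%classic = `[c - b, c - a[%classic.
    apply/seteqP; split => x; rewrite /iso/= !in_itv/= mulN1r;
      by move=> /andP[? ?]; apply/andP; split; lra.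
  rewrite !lebesgue_measure_itv/= !lte_fin ltrD2l ltrN2 -!EFinB.
  by congr (if _ then _%:E else _); ring.
Qed.

(** Isometries of the line are written x |-> s x + c with |s| = 1, so that
    reflections and translations are treated together. *)
Lemma ae_isometry (P : R -> Prop) s c : `|s| = 1 ->
  {ae mu, forall x, P x} -> {ae mu, forall x, P (s * x + c)}.
Proof.
move=> s1 [N [mN N0 PN]]; exists (iso s c @^-1` N); split.
- by rewrite -[X in measurable X]setTI; exact: miso.
- by rewrite lebesgue_measure_isometry.
- by move=> x /= Px; apply: PN.
Qed.

Let integralTiso s c (f : R -> \bar R) : `|s| = 1 -> measurable_fun setT f ->
  (forall x, 0 <= f x)%E -> (\int[mu]_x f (s * x + c)%R = \int[mu]_x f x)%E.
Proof.
move=> s1 mf f0.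
have := @ge0_integral_pushforward _ _ (measurableTypeR R) (measurableTypeR R) R
  (iso s c) (@miso s c) mu setT f measurableT mf.
rewrite preimage_setT /= => <-; last by move=> y _.
apply: eq_measure_integral => [|mi A mA _]; first exact: miso.
exact: (lebesgue_measure_isometry c s1 mA).
Qed.

Lemma measurable_isometry s c f : measurable_fun setT f ->
  measurable_fun setT (fun x : R => f (s * x + c)).
Proof. by move=> mf; apply: (measurableT_comp mf); exact: miso. Qed.

Lemma integrableR_isometry s c f : `|s| = 1 -> integrableR f ->
  integrableR (fun x : R => f (s * x + c)).
Proof.
move=> s1 /integrableP[/measurable_EFinP mf fi]; apply/integrableP; split.
  by apply/measurable_EFinP; apply: measurable_isometry.
have ma : measurable_fun setT (fun x => `|(f x)%:E|%E).
  by apply: measurableT_comp => //; exact/measurable_EFinP.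
by have /= -> := integralTiso c s1 ma (fun x => abse_ge0 _).
Qed.

Lemma Rint_isometry s c f : `|s| = 1 -> measurable_fun setT f ->
  \int[mu]_x f (s * x + c) = \int[mu]_x f x.
Proof.
move=> s1 mf; congr fine; rewrite integralE [RHS]integralE; congr (_ - _)%E.
  rewrite -[RHS](integralTiso c s1)//.
    by apply: eq_integral => x _; rewrite !funeposE.
  by apply: measurable_funepos; exact/measurable_EFinP.
rewrite -[RHS](integralTiso c s1)//.
  by apply: eq_integral => x _; rewrite !funenegE.
by apply: measurable_funeneg; exact/measurable_EFinP.
Qed.

End Affine.

(** * Square-integrable functions *)
Section SquareIntegrable.
Variable R : realType.
Notation mu := (@lebesgue_measure R).
Implicit Types f g psi : R -> R.

Lemma L2P f : L2 f <-> measurable_fun setT f /\ integrableR (fun x => f x ^+ 2).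
Proof.
split=> [hf|[mf hf]].
  by split; [move: hf => /sub_Lfun_mfun; rewrite inE|exact: Lfun2_integrable_sqr].
apply/andP; split; first by rewrite inE.
rewrite !inE /= /finite_norm unlock /=.
apply: poweR_lty; move: hf => /integrableP[_]; apply: le_lt_trans.
rewrite le_eqVlt; apply/orP; left; apply/eqP.
apply: eq_integral => x _; rewrite /= powR_mulrn// real_normK ?num_real//.
by rewrite ger0_norm// sqr_ge0.
Qed.

Lemma L2_measurable f : L2 f -> measurable_fun setT f.
Proof. by move=> /L2P[]. Qed.

Lemma L2_sqr f : L2 f -> integrableR (fun x => f x ^+ 2).
Proof. by move=> /L2P[]. Qed.

Lemma mulr_le_sqr (a b : R) : `|a * b| <= a ^+ 2 + b ^+ 2.
Proof.
have H : 0 <= (`|a| - `|b|) ^+ 2 by exact: sqr_ge0.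
rewrite normrM -(real_normK (num_real a)) -(real_normK (num_real b)).
have := normr_ge0 a; have := normr_ge0 b; nra.
Qed.

Lemma L2_mul f g : L2 f -> L2 g -> integrableR (fun x => f x * g x).
Proof.
move=> hf hg; apply: (@integrableR_le _ _ (fun x => f x ^+ 2 + g x ^+ 2)).
- by apply: measurable_funM; exact: L2_measurable.
- by apply: integrableRD; exact: L2_sqr.
- by apply: aeW => x; exact: mulr_le_sqr.
Qed.

Lemma L2Z c f : L2 f -> L2 (fun x => c * f x).
Proof.
move=> /L2P[mf hf]; apply/L2P; split; first exact: measurable_funM.
by have := integrableRZ (c ^+ 2) hf; under [in X in _ -> X]eq_fun do rewrite exprMn.
Qed.

Lemma L2D f g : L2 f -> L2 g -> L2 (fun x => f x + g x).
Proof.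
move=> hf hg; apply/L2P; split.
  by apply: measurable_funD; exact: L2_measurable.
have H := integrableRD (integrableRD (L2_sqr hf) (integrableRZ 2 (L2_mul hf hg))) (L2_sqr hg).
by under eq_fun do rewrite sqrrD -mulr_natl.
Qed.

Lemma L2B f g : L2 f -> L2 g -> L2 (fun x => f x - g x).
Proof.
move=> hf hg; under eq_fun do rewrite -[- _]mulN1r.
by apply: L2D => //; exact: L2Z.
Qed.

Lemma L2_isometry s c f : `|s| = 1 -> L2 f -> L2 (fun x : R => f (s * x + c)).
Proof.
move=> s1 /L2P[mf hf]; apply/L2P; split; first exact: measurable_isometry.
exact: (integrableR_isometry c s1 hf).
Qed.

(** The quadratic polynomial k |-> int (f - k g)^2 is nonnegative. *)
Lemma Rint_CauchySchwarz f g : L2 f -> L2 g ->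
  (\int[mu]_x (f x * g x)) ^+ 2 <= \int[mu]_x (f x ^+ 2) * \int[mu]_x (g x ^+ 2).
Proof.
move=> hf hg.
set A := \int[mu]_x (f x * g x); set F := \int[mu]_x (f x ^+ 2).
set G := \int[mu]_x (g x ^+ 2).
have H k : 0 <= F - 2 * k * A + k ^+ 2 * G.
  have -> : F - 2 * k * A + k ^+ 2 * G = \int[mu]_x ((f x - k * g x) ^+ 2).
    rewrite /F /A /G -!RintZ ?L2_mul ?L2_sqr//.
    rewrite -RintB; [|exact: L2_sqr|by apply: integrableRZ; exact: L2_mul].
    rewrite -RintD; [|by apply: integrableRB; [exact: L2_sqr|
      apply: integrableRZ; exact: L2_mul]|by apply: integrableRZ; exact: L2_sqr].
    by congr Rintegral; apply/funext => x; ring.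
  by apply: Rintegral_ge0 => x _; exact: sqr_ge0.
have G0 : 0 <= G by apply: Rintegral_ge0 => x _; exact: sqr_ge0.
have [G00|Gn0] := eqVneq G 0.
  rewrite G00 mulr0; have [->|An0] := eqVneq A 0; first by rewrite expr0n.
  (* When G = 0 the polynomial is affine, and takes the value -1 at this k. *)
  have := H ((F + 1) / (2 * A)); rewrite G00 mulr0 addr0.
  have -> : 2 * ((F + 1) / (2 * A)) * A = F + 1 by field.
  by lra.
have := H (A / G).
have -> : F - 2 * (A / G) * A + (A / G) ^+ 2 * G = F - A ^+ 2 / G by field.
by rewrite subr_ge0 ler_pdivrMr// lt_neqAle eq_sym Gn0.
Qed.

Lemma integrableR_indic (a b : R) : integrableR (\1_(`[a, b]%classic) : R -> R).
Proof. exact: integrable_indic_itv. Qed.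

Lemma integrableR_bounded f (a b C : R) : measurable_fun setT f ->
  {ae mu, forall x, `|f x| <= C * \1_(`[a, b]%classic) x} -> integrableR f.
Proof.
by move=> mf fC; apply: integrableR_le fC => //; apply: integrableRZ; exact: integrableR_indic.
Qed.

Lemma indicE01 (a b x : R) : \1_(`[a, b]%classic) x = ((a <= x <= b)%R)%:R :> R.
Proof. by rewrite indicE mem_setE in_itv. Qed.

Lemma smooth_cpt_measurable psi : smooth_cpt psi -> measurable_fun setT psi.
Proof. by move=> hp; apply: continuous_measurable_fun; exact: smooth_cpt_continuous. Qed.

Lemma smooth_cpt_indic psi : smooth_cpt psi ->
  exists C L, [/\ 0 < C, 0 < L & forall x, `|psi x| <= C * \1_(`[- L, L]%classic) x].
Proof.
move=> hp; have [C [C0 HC]] := smooth_cpt_bounded hp.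
have [L [L0 HL]] := smooth_cpt_radius hp.
exists C, L; split => // x; rewrite indicE01 -ler_norml.
by have [_|xL] := leP `|x| L; rewrite ?mulr1// HL ?normr0 ?mulr0// ltW.
Qed.

Lemma smooth_cpt_integrable psi : smooth_cpt psi -> integrableR psi.
Proof.
move=> hp; have [C [L [_ _ H]]] := smooth_cpt_indic hp.
by apply: (integrableR_bounded (smooth_cpt_measurable hp)); apply: aeW; exact: H.
Qed.

Lemma smooth_cpt_L2 psi : smooth_cpt psi -> L2 psi.
Proof.
move=> hp; apply/L2P; split; first exact: smooth_cpt_measurable.
have [C [C0 HC]] := smooth_cpt_bounded hp.
apply: (@integrableR_le _ _ (fun x => C * `|psi x|)).
- by apply: measurable_funX; exact: smooth_cpt_measurable.
- by apply: integrableRZ; apply: integrableR_norm; exact: smooth_cpt_integrable.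
- by apply: aeW => x; rewrite expr2 normrM ler_wpM2r.
Qed.

Lemma L2_mul_test f psi : L2 f -> smooth_cpt psi -> integrableR (fun x => f x * psi x).
Proof. by move=> hf hp; apply: L2_mul => //; exact: smooth_cpt_L2. Qed.

Lemma L2_locally_integrable f : L2 f -> locally_integrable setT f.
Proof.
move=> hf; split; [exact: L2_measurable|exact: openT|move=> K _ cK].
have mK := compact_measurable cK.
have Kfin : (mu K < +oo)%E.
  have [M [_ HM]] := compact_bounded cK.
  have KM : K `<=` `[- (`|M| + 1), `|M| + 1]%classic.
    move=> x Kx; rewrite /= in_itv/= -ler_norml.
    by apply: HM => //; rewrite (le_lt_trans (ler_norm M))// ltrDl.
  apply: (@le_lt_trans _ _ (mu `[- (`|M| + 1), `|M| + 1]%classic)).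
    by apply: le_measure => //; rewrite inE.
  by rewrite lebesgue_measure_itv/=; case: ifPn => // _; rewrite -EFinB ltry.
have H1 : mu.-integrable K (EFin \o (fun x => 1 + f x ^+ 2)).
  have := @integrableD _ _ _ mu K mK (EFin \o cst 1) (EFin \o (fun x => f x ^+ 2)).
  apply.
    by apply: measurable_bounded_integrable => //; exact: bounded_cst.
  exact: (@integrableS _ _ _ mu setT K _ measurableT mK (@subsetT _ K) (L2_sqr hf)).
move: H1 => /integrableP[m1]; apply: le_lt_trans.
apply: ge0_le_integral => //=.
- apply/measurable_EFinP; apply: measurableT_comp => //.
  by apply: measurable_funS (L2_measurable hf).
- apply/measurable_EFinP; apply: measurableT_comp => //; exact/measurable_EFinP.
move=> x _; rewrite lee_fin [leRHS]ger0_norm ?addr_ge0 ?sqr_ge0//.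
rewrite -(real_normK (num_real (f x))).
have := sqr_ge0 (`|f x| - 1); have := normr_ge0 (f x); nra.
Qed.

End SquareIntegrable.

(** * Mollification at Lebesgue points *)
Section Mollifier.
Variable R : realType.
Notation mu := (@lebesgue_measure R).
Implicit Types f g psi : R -> R.

Lemma Rint_bump (e x : R) : 0 < e -> \int[mu]_y bump e x y = 1.
Proof.
move=> e0; set J := `[x - 2 * e, x + 2 * e]%classic.
have -> : bump e x = bump e x \_ J.
  apply/funext => y; rewrite patchE; case: ifPn => // yJ.
  apply: bump_eq0 => //; rewrite ltNge; apply: contra yJ => yx.
  by rewrite inE /J /= in_itv/=; move: yx; rewrite ler_distl; lra.
rewrite -Rintegral_mkcond /Rintegral.
have cb := smooth_cpt_continuous (bump_smooth_cpt x e0).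
have cs : continuous (step e x) by exact: (Ck_continuous (step_smooth e x 0)).
rewrite (@continuous_FTC2 _ (bump e x) (step e x)) //=.
- by rewrite step_eq1 ?step_eq0 ?subr0//; lra.
- lra.
- exact: continuous_subspaceT.
- split.
  + by move=> y _; exact: derivable_step.
  + by apply: cvg_at_right_filter; exact: cs.
  + by apply: cvg_at_left_filter; exact: cs.
Qed.

Lemma locally_integrable_itv f (a b : R) : locally_integrable setT f ->
  mu.-integrable `[a, b] (EFin \o f).
Proof.
move=> [mf _ lf]; apply/integrableP; split.
  by apply/measurable_EFinP; exact: measurable_funS mf.
by apply: lf => //; exact: segment_compact.
Qed.

Lemma locally_integrable_bump f (e x : R) : 0 < e -> locally_integrable setT f ->
  integrableR (fun y => f y * bump e x y).
Proof.
move=> e0 lf; set J := `[x - e, x + e]%classic.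
have hJ : integrableR (f \_ J).
  have := locally_integrable_itv (x - e) (x + e) lf.
  by move/integrable_mkcond; rewrite restrict_EFin; apply.
have [C [C0 HC]] := bump_bound R.
apply: (@integrableR_le _ _ (fun y => C / e * `|(f \_ J) y|)).
- apply: measurable_funM; first by case: lf.
  exact: smooth_cpt_measurable (bump_smooth_cpt x e0).
- by apply: integrableRZ; exact: integrableR_norm.
- apply: aeW => y; rewrite patchE; case: ifPn => yJ.
    by rewrite normrM mulrC ler_wpM2r// HC.
  rewrite bump_eq0 ?mulr0 ?normr0 ?mulr0//.
  rewrite ltNge; apply: contra yJ => yx.
  by rewrite inE /J /= in_itv/=; move: yx; rewrite ler_distl; lra.
Qed.

(** The bump of width [e] is bounded by C / e and vanishes outside a ball of
    radius 2 e, so the error is at most a constant times the mean of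
    |f - f x| over that ball. *)
Lemma bump_cvg f x : locally_integrable setT f -> lebesgue_pt f x ->
  \int[mu]_y (f y * bump e x y) @[e --> 0^'+] --> f x.
Proof.
move=> lf fx; have [C [C0 HC]] := bump_bound R.
apply/cvgrPdist_le => d d0.
have d1 : 0 < d / (4 * C) by rewrite divr_gt0// mulr_gt0.
have [r /= r0 Hr] : \forall e \near 0^'+, (davg f x e < (d / (4 * C))%:E)%E.
  have d1E : (0 < (d / (4 * C))%:E)%E by rewrite lte_fin.
  exact: (fx _ (open_ereal_lt' d1E)).
near=> e.
have e0 : 0 < e by near: e; exact: nbhs_right_gt.
have er : e < r / 2 by near: e; apply: nbhs_right_lt; rewrite divr_gt0.
have H : (davg f x (2 * e) < (d / (4 * C))%:E)%E.
  by apply: Hr; rewrite /= ?sub0r ?normrN ?gtr0_norm; lra.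
have e20 : 0 < 2 * e by rewrite mulr_gt0.
set B := ball x (2 * e).
have mB : measurable B by exact: measurable_ball.
have hB : mu.-integrable B (EFin \o (fun y => f y - f x)).
  apply: (@integrableS _ _ _ mu `[x - 2 * e, x + 2 * e]%classic) => //.
    move=> y; rewrite /B /ball/= in_itv/= => yx.
    by move: yx; rewrite ltr_distl; lra.
  apply: (@integrableB _ _ _ mu _ _ _ (fun=> (f x)%:E) (locally_integrable_itv _ _ lf)) => //.
  apply: (@measurable_bounded_integrable _ _ _ mu (fun=> f x)) => //.
    by rewrite /= lebesgue_measure_itv/=; case: ifPn => // _; rewrite -EFinB ltry.
  exact: bounded_cst.
have hBT : integrableR ((fun y => f y - f x) \_ B).
  by move: hB => /integrable_mkcond; rewrite restrict_EFin; apply.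
have -> : f x - \int[mu]_y (f y * bump e x y) = - \int[mu]_y ((f y - f x) * bump e x y).
  have -> : \int[mu]_y ((f y - f x) * bump e x y) =
      \int[mu]_y (f y * bump e x y - f x * bump e x y).
    by congr Rintegral; apply/funext => y; ring.
  rewrite RintB; [|exact: locally_integrable_bump|].
    rewrite RintZ ?Rint_bump ?mulr1 ?opprB//.
    exact: smooth_cpt_integrable (bump_smooth_cpt x e0).
  by apply: integrableRZ; exact: smooth_cpt_integrable (bump_smooth_cpt x e0).
rewrite normrN.
have le1 : `|\int[mu]_y ((f y - f x) * bump e x y)| <=
    \int[mu]_y (C / e * `|((fun y => f y - f x) \_ B) y|).
  apply: normr_Rint_le.
  - apply: measurable_funM.
      by apply: measurable_funB => //; case: lf.
    exact: smooth_cpt_measurable (bump_smooth_cpt x e0).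
  - by apply: integrableRZ; exact: integrableR_norm.
  - move=> y; rewrite patchE; case: ifPn => yB.
      by rewrite normrM mulrC ler_wpM2r// HC.
    rewrite bump_eq0 ?mulr0 ?normr0 ?mulr0//.
    rewrite ltNge; apply: contra yB => yx.
    rewrite inE /B /ball /= distrC (le_lt_trans yx)//; lra.
apply: (le_trans le1); rewrite RintZ; last exact: integrableR_norm.
have -> : \int[mu]_y `|((fun y => f y - f x) \_ B) y| = \int[mu]_(y in B) `|f y - f x|.
  rewrite [RHS]Rintegral_mkcond; congr Rintegral; apply/funext => y.
  by rewrite !patchE; case: ifPn => // _; rewrite normr0.
have le2 : \int[mu]_(y in B) `|f y - f x| <= d / (4 * C) * (4 * e).
  rewrite -lee_fin /Rintegral fineK; last first.
    by apply: (@integrable_fin_num _ _ _ mu B _ _ (integrable_norm hB)); exact: measurable_ball.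
  move: H; rewrite /davg /iavg -/B lebesgue_measure_ball ?(ltW e20)//.
  rewrite inver gt_eqF; last by rewrite pmulrn_lgt0.
  rewrite lte_pdivrMl ?pmulrn_lgt0// => /ltW H.
  apply: (le_trans H); rewrite -EFinM lee_fin -mulr_natl; lra.
apply: (@le_trans _ _ (C / e * (d / (4 * C) * (4 * e)))).
  by apply: ler_wpM2l => //; rewrite divr_ge0 ?ltW.
rewrite (_ : C / e * (d / (4 * C) * (4 * e)) = d)//; field.
by rewrite !gt_eqF.
Unshelve. all: by end_near. Qed.

(** Almost every point is a Lebesgue point, and there the value is the limit of
    the pairings with bumps. *)
Lemma L2_test_eq0 f : L2 f ->
  (forall psi, smooth_cpt psi -> \int[mu]_x (f x * psi x) = 0) ->
  {ae mu, forall x, f x = 0}.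
Proof.
move=> hf H0; have lf := L2_locally_integrable hf.
apply: (ae_mono (lebesgue_differentiation lf)) => x fx.
have H := bump_cvg lf fx.
have H1 : \int[mu]_y (f y * bump e x y) @[e --> 0^'+] --> (0 : R).
  apply: cvg_near_cst; near=> e; apply: H0; apply: bump_smooth_cpt.
  by near: e; exact: nbhs_right_gt.
exact: (cvg_unique _ H H1).
Unshelve. all: by end_near. Qed.

End Mollifier.

(** * Functions with a square-integrable weak derivative *)
Section SobolevFacts.
Variable R : realType.
Notation mu := (@lebesgue_measure R).
Implicit Types f g psi : R -> R.

Lemma Rint_indic (a b : R) : a <= b -> \int[mu]_x (\1_(`[a, b]%classic) x : R) = b - a.
Proof.
move=> ab; rewrite /Rintegral integral_indic// setIT /= lebesgue_measure_itv/= lte_fin.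
move: ab; rewrite le_eqVlt => /predU1P[->|->]; last by rewrite -EFinB.
by rewrite ltxx subrr.
Qed.

Lemma weak_derivativeP f g : weak_derivative f g <->
  forall psi, smooth_cpt psi ->
  \int[mu]_x (f x * psi^`()%classic x) = - \int[mu]_x (g x * psi x).
Proof. by split=> H psi hp; apply: H; apply/test_functionP. Qed.

Lemma weak_derivative_unique f g1 g2 : L2 g1 -> L2 g2 ->
  weak_derivative f g1 -> weak_derivative f g2 -> {ae mu, forall x, g1 x = g2 x}.
Proof.
move=> L1 L2 /weak_derivativeP d1 /weak_derivativeP d2.
have : {ae mu, forall x, g1 x - g2 x = 0}.
  apply: L2_test_eq0; first exact: L2B.
  move=> psi hp; have -> : \int[mu]_x ((g1 x - g2 x) * psi x) =
      \int[mu]_x (g1 x * psi x - g2 x * psi x).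
    by congr Rintegral; apply/funext => x; ring.
  rewrite RintB; [|exact: L2_mul_test|exact: L2_mul_test].
  by apply/eqP; rewrite subr_eq0 -eqr_opp -d1// -d2.
by move/ae_mono; apply => x /eqP; rewrite subr_eq0 => /eqP.
Qed.

Lemma wderivP f : H1 f -> L2 (wderiv f) /\ weak_derivative f (wderiv f).
Proof.
move=> [_ [g gP]].
by have : [set g | L2 g /\ weak_derivative f g] (wderiv f) by apply: xgetPex; exists g.
Qed.

Lemma H1_L2 f : H1 f -> L2 f. Proof. by case. Qed.
Lemma wderiv_L2 f : H1 f -> L2 (wderiv f). Proof. by move=> /wderivP[]. Qed.

Lemma wderiv_unique f g : H1 f -> L2 g -> weak_derivative f g ->
  {ae mu, forall x, wderiv f x = g x}.
Proof.
move=> hf hg fg; have [hw fw] := wderivP hf.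
exact: weak_derivative_unique hw hg fw fg.
Qed.

Lemma weak_derivative_ae f1 f2 g : measurable_fun setT f1 -> measurable_fun setT f2 ->
  {ae mu, forall x, f2 x = f1 x} -> weak_derivative f1 g -> weak_derivative f2 g.
Proof.
move=> m1 m2 f12 /weak_derivativeP d; apply/weak_derivativeP => psi hp.
have mp := smooth_cpt_measurable (smooth_cpt_derive hp).
rewrite -d//; apply: ae_eq_Rint; try exact: measurable_funM.
by apply: (ae_mono f12) => x ->.
Qed.

(** The change of variables y = s x + c carries the test function [psi] to
    psi (s y - s c), because s * s = 1. *)
Lemma weak_derivative_isometry s c f g : `|s| = 1 -> L2 f -> L2 g ->
  weak_derivative f g ->
  weak_derivative (fun x : R => f (s * x + c)) (fun x => s * g (s * x + c)).
Proof.
move=> s1 hf hg /weak_derivativeP d; apply/weak_derivativeP => psi hp.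
have ss : s * s = 1.
  by rewrite -expr2 -(real_normK (num_real s)) s1 expr1n.
have s0 : s != 0 by rewrite -normr_gt0 s1.
pose phi y := psi (s * y + (- (s * c))).
have hphi : smooth_cpt phi by exact: smooth_cpt_affine.
have phi' y : phi^`()%classic y = s * psi^`()%classic (s * y + (- (s * c))).
  by rewrite derive1_affine//; exact: smooth_cpt_derivable.
have back (h : R -> R) x : h (s * (s * x + c) + (- (s * c))) = h x.
  by congr h; rewrite mulrDr mulrA ss; ring.
have mf := L2_measurable hf; have mg := L2_measurable hg.
have -> : \int[mu]_x (f (s * x + c) * psi^`()%classic x) =
    \int[mu]_y (f y * (s * phi^`()%classic y)).
  rewrite -[RHS](Rint_isometry c s1); last first.
    apply: measurable_funM => //; apply: measurable_funM => //.
    exact: smooth_cpt_measurable (smooth_cpt_derive hphi).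
  congr Rintegral; apply/funext => x.
  by rewrite phi' (back psi^`()%classic) !mulrA -(mulrA _ s s) ss mulr1.
have -> : \int[mu]_x (s * g (s * x + c) * psi x) = \int[mu]_y (s * (g y * phi y)).
  rewrite -[RHS](Rint_isometry c s1); last first.
    apply: measurable_funM => //; apply: measurable_funM => //.
    exact: smooth_cpt_measurable hphi.
  by congr Rintegral; apply/funext => x; rewrite /phi back mulrA.
rewrite RintZ; last exact: L2_mul_test.
rewrite -mulrN -d// -RintZ; last by apply: L2_mul_test => //; exact: smooth_cpt_derive.
by congr Rintegral; apply/funext => x; ring.
Qed.

Lemma H1_isometry s c f : `|s| = 1 -> H1 f -> H1 (fun x : R => f (s * x + c)).
Proof.
move=> s1 hf; have [hw fw] := wderivP hf; split; first exact: L2_isometry (H1_L2 hf).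
exists (fun x => s * wderiv f (s * x + c)); split.
  by apply: L2Z; exact: L2_isometry.
exact: weak_derivative_isometry (H1_L2 hf) hw fw.
Qed.

Lemma wderiv_isometry s c f1 f2 : `|s| = 1 -> H1 f1 -> H1 f2 ->
  {ae mu, forall x, f2 x = f1 (s * x + c)} ->
  {ae mu, forall x, wderiv f2 x = s * wderiv f1 (s * x + c)}.
Proof.
move=> s1 h1 h2 f12; have [hw fw] := wderivP h1.
apply: wderiv_unique => //; first by apply: L2Z; exact: L2_isometry.
apply: (@weak_derivative_ae (fun x => f1 (s * x + c))) => //.
- exact: L2_measurable (L2_isometry c s1 (H1_L2 h1)).
- exact: L2_measurable (H1_L2 h2).
- exact: weak_derivative_isometry (H1_L2 h1) hw fw.
Qed.

Lemma weak_derivativeB f1 f2 g1 g2 : L2 f1 -> L2 f2 -> L2 g1 -> L2 g2 ->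
  weak_derivative f1 g1 -> weak_derivative f2 g2 ->
  weak_derivative (fun x => f1 x - f2 x) (fun x => g1 x - g2 x).
Proof.
move=> h1 h2 k1 k2 /weak_derivativeP d1 /weak_derivativeP d2.
apply/weak_derivativeP => psi hp; have hp' := smooth_cpt_derive hp.
have E (a b c : R -> R) : (fun x => (a x - b x) * c x) = (fun x => a x * c x - b x * c x).
  by apply/funext => x; rewrite mulrBl.
rewrite !E RintB ?L2_mul_test// RintB ?L2_mul_test// d1// d2//; ring.
Qed.

Definition energy f := \int[mu]_x (f x ^+ 2) + \int[mu]_x (wderiv f x ^+ 2).

Lemma Rint_sqr_ge0 f : 0 <= \int[mu]_x (f x ^+ 2).
Proof. by apply: Rintegral_ge0 => x _; exact: sqr_ge0. Qed.

Lemma energy_ge0 f : 0 <= energy f.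
Proof. by rewrite addr_ge0 ?Rint_sqr_ge0. Qed.

Lemma H1norm_sqr f : H1norm f ^+ 2 = energy f.
Proof. by rewrite sqr_sqrtr ?energy_ge0. Qed.

Lemma Rint_sqr_le f g : L2 f -> L2 g ->
  \int[mu]_x (f x ^+ 2) <= 2 * \int[mu]_x (g x ^+ 2) + 2 * \int[mu]_x ((f x - g x) ^+ 2).
Proof.
move=> hf hg; have hB := L2B hf hg.
rewrite -!RintZ; [|exact: L2_sqr hB|exact: L2_sqr].
rewrite -RintD; [|by apply: integrableRZ; exact: L2_sqr|by apply: integrableRZ; exact: L2_sqr hB].
apply: ae_le_Rint; first exact: L2_sqr.
  by apply: integrableRD; apply: integrableRZ; [exact: L2_sqr|exact: L2_sqr hB].
apply: aeW => x; have := sqr_ge0 (f x - 2 * g x); nra.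
Qed.

Lemma energy_triangle f g : H1 f -> H1 g ->
  energy f <= 2 * energy g + 2 * energy (f \- g).
Proof.
move=> hf hg; have [wf df] := wderivP hf; have [wg dg] := wderivP hg.
have hB := weak_derivativeB (H1_L2 hf) (H1_L2 hg) wf wg df dg.
have H1B : H1 (f \- g).
  split; first exact: L2B (H1_L2 hf) (H1_L2 hg).
  by exists (fun x => wderiv f x - wderiv g x); split => //; exact: L2B.
have dE : \int[mu]_x (wderiv (f \- g) x ^+ 2) = \int[mu]_x ((wderiv f x - wderiv g x) ^+ 2).
  apply: ae_eq_Rint.
  - by apply: measurable_funX; apply: L2_measurable; exact: wderiv_L2.
  - by apply: measurable_funX; apply: L2_measurable; exact: L2B.
  - by apply: (ae_mono (wderiv_unique H1B (L2B wf wg) hB)) => x ->.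
rewrite /energy dE.
apply: le_trans (lerD (Rint_sqr_le (H1_L2 hf) (H1_L2 hg)) (Rint_sqr_le wf wg)) _.
by rewrite addrACA -!mulrDr lexx.
Qed.

Lemma bump_increment f g (e x y : R) : 0 < e -> x <= y -> L2 f -> L2 g ->
  weak_derivative f g ->
  \int[mu]_z (f z * bump e x z) - \int[mu]_z (f z * bump e y z) =
  - \int[mu]_z (g z * (step e x z - step e y z)).
Proof.
move=> e0 xy hf hg /weak_derivativeP d.
rewrite -RintB; [|by apply: L2_mul_test => //; exact: bump_smooth_cpt
  |by apply: L2_mul_test => //; exact: bump_smooth_cpt].
rewrite -d; last exact: step_sub_smooth_cpt.
rewrite derive_step_sub; apply: (congr1 (Rintegral mu setT)); apply/funext => z.
by rewrite mulrBr.
Qed.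

(** A form of the embedding of H^1 in the continuous functions. The pairing of
    [f] with the difference of two bumps tends to [f x - f y]; it is also the
    opposite of the pairing of [g] with a difference of two steps, which
    approximates the indicator function of [x, y]. *)
Lemma lebesgue_pt_increment f g (x y : R) : x <= y -> L2 f -> L2 g ->
  weak_derivative f g -> lebesgue_pt f x -> lebesgue_pt f y ->
  `|f x - f y| <= 2^-1 * (\int[mu]_z (g z ^+ 2) + (y - x)).
Proof.
move=> xy hf hg d fx fy; have lf := L2_locally_integrable hf.
have cx := bump_cvg lf fx; have cy := bump_cvg lf fy.
have cxy : `|\int[mu]_z (f z * bump e x z) - \int[mu]_z (f z * bump e y z)|
    @[e --> 0^'+] --> `|f x - f y|.
  by apply: cvg_norm; apply: cvgB.
have ce : 2^-1 * (\int[mu]_z (g z ^+ 2) + (y - x + 2 * e)) @[e --> 0^'+] -->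
    2^-1 * (\int[mu]_z (g z ^+ 2) + (y - x)).
  rewrite -[in X in _ --> X](addr0 (y - x)) -[X in _ - _ + X](mulr0 2).
  apply: cvgM; first exact: cvg_cst.
  apply: cvgD; first exact: cvg_cst.
  apply: cvgD; first exact: cvg_cst.
  apply: cvgM; first exact: cvg_cst.
  exact: cvg_at_right_filter.
apply: (ler_cvg_to cxy ce); near=> e.
have e0 : 0 < e by near: e; exact: nbhs_right_gt.
rewrite /= (bump_increment e0 xy hf hg d) normrN.
have hs := step_sub_smooth_cpt x y e0.
have hI := Rint_indic (a := x - e) (b := y + e).
have -> : y - x + 2 * e = \int[mu]_z (\1_(`[x - e, y + e]%classic) z).
  by rewrite hI; lra.
have hi := @integrableR_indic R (x - e) (y + e).
rewrite -RintD; [|exact: L2_sqr|exact: hi].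
rewrite -RintZ; last by apply: integrableRD; [exact: L2_sqr|exact: hi].
apply: normr_Rint_le.
- exact: integrableR_measurable (L2_mul_test hg hs).
- by apply: integrableRZ; apply: integrableRD; [exact: L2_sqr|exact: hi].
- move=> z; rewrite indicE01.
  have [zI|zI] /= := boolP (x - e <= z <= y + e).
    rewrite normrM; have := step_sub_le e x y z; have := normr_ge0 (g z).
    rewrite -(real_normK (num_real (g z))).
    have := normr_ge0 (step e x z - step e y z); have := sqr_ge0 (`|g z| - 1); nra.
  rewrite step_sub_eq0 ?mulr0 ?normr0//.
    by rewrite mulr_ge0// addr_ge0 ?sqr_ge0.
  by move: zI; rewrite negb_and -!ltNge => /orP[]/ltW; [left|right].
Unshelve. all: by end_near. Qed.

(** The mean of |f x| <= |f x - f y| + |f y| over y in [x, x + 1]. *)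
Lemma ae_bound_H1 f : H1 f -> {ae mu, forall x, `|f x| <= energy f + 1}.
Proof.
move=> hf; have [hw fw] := wderivP hf; have L2f := H1_L2 hf.
have leb := lebesgue_differentiation (L2_locally_integrable L2f).
apply: (ae_mono leb) => x fx.
set G := \int[mu]_z (wderiv f z ^+ 2).
have hI := @integrableR_indic R x (x + 1).
have I1 : \int[mu]_z (\1_(`[x, x + 1]%classic) z : R) = 1.
  by rewrite Rint_indic; lra.
have hr : integrableR (fun y => 2^-1 * f y ^+ 2 + (2^-1 * (G + 2)) * \1_(`[x, x + 1]%classic) y).
  by apply: integrableRD; apply: integrableRZ => //; exact: L2_sqr.
have : \int[mu]_y (`|f x| * \1_(`[x, x + 1]%classic) y) <=
   \int[mu]_y (2^-1 * f y ^+ 2 + (2^-1 * (G + 2)) * \1_(`[x, x + 1]%classic) y).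
  apply: ae_le_Rint => //; first exact: integrableRZ.
  apply: (ae_mono leb) => y fy; rewrite indicE01.
  have [/andP[xy yx]|_] /= := boolP (x <= y <= x + 1); last first.
    by rewrite !mulr0 addr0 mulr_ge0// sqr_ge0.
  have H := lebesgue_pt_increment xy L2f hw fw fx fy.
  have T : `|f x| <= `|f x - f y| + `|f y| by rewrite -{1}(subrK (f y) (f x)) ler_normD.
  rewrite -(real_normK (num_real (f y))) -/G in H *.
  have := sqr_ge0 (`|f y| - 1); rewrite !mulr1; nra.
rewrite RintZ// I1 RintD; [|by apply: integrableRZ; exact: L2_sqr|exact: integrableRZ].
rewrite !RintZ ?I1//; last exact: L2_sqr.
have := Rint_sqr_ge0 f; have := Rint_sqr_ge0 (wderiv f).
rewrite /energy -/G !mulr1; lra.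
Qed.

(** [f] takes the same value at all its Lebesgue points, and a nonzero constant
    is not square integrable on the line. *)
Lemma weak_derivative0 f : L2 f -> weak_derivative f (cst 0) ->
  {ae mu, forall x, f x = 0}.
Proof.
move=> hf fd; have lf := L2_locally_integrable hf.
have leb := lebesgue_differentiation lf.
have L20 : L2 (cst 0 : R -> R).
  by have := L2Z 0 hf; under eq_fun do rewrite mul0r.
have eqf x y : x <= y -> lebesgue_pt f x -> lebesgue_pt f y -> f x = f y.
  move=> xy fx fy; have cx := bump_cvg lf fx; have cy := bump_cvg lf fy.
  apply/eqP; rewrite -subr_eq0; apply/eqP.
  have cxy : \int[mu]_z (f z * bump e x z) - \int[mu]_z (f z * bump e y z)
    @[e --> 0^'+] --> f x - f y by exact: cvgB.
  apply: (cvg_unique _ cxy) => //.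
  apply: cvg_near_cst; near=> e.
  have e0 : 0 < e by near: e; exact: nbhs_right_gt.
  rewrite /= (bump_increment e0 xy hf L20 fd).
  have -> : (fun z => cst 0 z * (step e x z - step e y z)) = cst (0 : R).
    by apply/funext => z; rewrite /= mul0r.
  by rewrite Rintegral_cst// mul0r oppr0.
apply: (ae_mono leb) => x fx; apply/eqP; apply/negPn/negP => fx0.
set F := \int[mu]_z (f z ^+ 2).
have F0 : 0 <= F by exact: Rint_sqr_ge0.
have c0 : 0 < f x ^+ 2 by rewrite lt_neqAle sqr_ge0 eq_sym sqrf_eq0 fx0.
(* An interval long enough for the constant f x to have too large a square
   integral. *)
set n := (F + 1) / f x ^+ 2.
have n0 : 0 < n by rewrite divr_gt0// ltr_wpDl.
have : \int[mu]_y (f x ^+ 2 * \1_(`[x, x + n]%classic) y) <= F.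
  apply: ae_le_Rint; [by apply: integrableRZ; exact: integrableR_indic|exact: L2_sqr|].
  apply: (ae_mono leb) => y fy; rewrite indicE01.
  have [/andP[xy _]|_] /= := boolP (x <= y <= x + n).
    by rewrite mulr1 (eqf _ _ xy).
  by rewrite mulr0 sqr_ge0.
rewrite RintZ; last exact: integrableR_indic.
rewrite Rint_indic; last by rewrite lerDl ltW.
rewrite [x + n]addrC addrK /n mulrC divfK ?gt_eqF//; lra.
Unshelve. all: by end_near. Qed.

End SobolevFacts.

(** * The flux of the equation *)
Section Flux.
Variable R : realType.
Notation mu := (@lebesgue_measure R).
Implicit Types f g psi : R -> R.

(** Twice the kernel of (1 - d_x^2)^-1. *)
Definition kernel (x : R) : R := expR (- `|x|).

Lemma kernel_gt0 x : 0 < kernel x. Proof. exact: expR_gt0. Qed.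

Lemma kernel_le1 x : kernel x <= 1.
Proof. by rewrite /kernel expR_le1 oppr_le0. Qed.

Lemma kernel_continuous : continuous kernel.
Proof.
move=> x; have cn : - `|y| @[y --> x] --> - `|x|.
  by apply: cvgN; exact: (@norm_continuous _ R^o).
rewrite /continuous_at; apply: continuous_cvg cn; exact: continuous_expR.
Qed.

Lemma kernel_measurable : measurable_fun setT kernel.
Proof. by apply: continuous_measurable_fun; exact: kernel_continuous. Qed.

Lemma kernel_integrable : integrableR kernel.
Proof.
have hp : integrableR (exponential_pdf (1 : R)) by exact: integrable_exponential_pdf.
have hm : integrableR (fun y : R => exponential_pdf (1 : R) (- 1 * y + 0)).
  by apply: integrableR_isometry => //; rewrite normrN normr1.
apply: (@integrableR_le _ _ (fun y => exponential_pdf 1 y + exponential_pdf 1 (- 1 * y + 0))).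
- exact: kernel_measurable.
- exact: integrableRD.
- apply: aeW => y; rewrite mulN1r addr0 gtr0_norm ?kernel_gt0// /kernel.
  have [y0|/ltW y0] := leP 0 y.
    rewrite exponential_pdfE// mul1r mulN1r ger0_norm//.
    by rewrite lerDl exponential_pdf_ge0.
  rewrite (@exponential_pdfE _ 1 (- y)) ?oppr_ge0// mul1r mulN1r ler0_norm//.
  by rewrite lerDr exponential_pdf_ge0.
Qed.

Definition kernel_mass := \int[mu]_y kernel y.

Lemma kernel_mass_ge0 : 0 <= kernel_mass.
Proof. by apply: Rintegral_ge0 => y _; exact: ltW (kernel_gt0 y). Qed.

Lemma kernel_shiftE (x y : R) : kernel (x - y) = kernel (-1 * y + x).
Proof. by congr kernel; ring. Qed.

Lemma kernel_shift_integrable x : integrableR (fun y => kernel (x - y)).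
Proof.
under eq_fun do rewrite kernel_shiftE.
by apply: integrableR_isometry; [rewrite normrN normr1|exact: kernel_integrable].
Qed.

Lemma kernel_shift_mass x : \int[mu]_y kernel (x - y) = kernel_mass.
Proof.
under eq_Rintegral do rewrite kernel_shiftE.
by rewrite Rint_isometry// ?normrN ?normr1//; exact: kernel_measurable.
Qed.

(** The increment is relative to the value of the kernel itself, so integrating
    against [nonlin f] costs no more than the bound on [helmholtz_inv]. *)
Lemma kernel_increment (x x' y : R) :
  `|kernel (x - y) - kernel (x' - y)| <= (expR `|x - x'| - 1) * kernel (x - y).
Proof.
set a := `|x - y|; set b := `|x' - y|; set d := `|x - x'|.
have ab : `|a - b| <= d.
  by rewrite (le_trans (ler_dist_dist _ _))// /d; rewrite (_ : _ - _ - _ = x - x')//; ring.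
have e1 : expR (- b) <= expR d * expR (- a).
  by rewrite -expRD ler_expR; move: ab; rewrite ler_norml; lra.
have e2 : expR (- d) * expR (- a) <= expR (- b).
  by rewrite -expRD ler_expR; move: ab; rewrite ler_norml; lra.
(* Turns the factor 1 - exp(- d) of the lower bound into exp(d) - 1. *)
have e3 : 2 - expR d <= expR (- d).
  rewrite expRN -[leRHS]mul1r ler_pdivlMr ?expR_gt0//.
  by have := sqr_ge0 (expR d - 1); nra.
have a0 := expR_gt0 (- a).
rewrite /kernel -/a -/b ler_norml; nra.
Qed.

Lemma nonlin_measurable f : H1 f -> measurable_fun setT (nonlin f).
Proof.
move=> hf; have mf := L2_measurable (H1_L2 hf).
have mw := L2_measurable (wderiv_L2 hf).
have mX n := measurable_funX n mf.
apply: measurable_funB; last by apply: measurable_funM => //; exact: measurable_funX.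
apply: measurable_funD; last by apply: measurable_funM => //; exact: mX.
apply: measurable_funB; last by apply: measurable_funM => //; exact: mX.
apply: measurable_funD; last by apply: measurable_funM => //; exact: mX.
exact: measurable_funM.
Qed.

Definition nonlin_bound (M : R) := 2 * M + 10 * M ^+ 2 + 2 * M ^+ 3 + 3 * M ^+ 4.

(** The powers of [f] are bounded since [f] is; the square of the weak
    derivative is merely integrable. *)
Lemma nonlin_le f : H1 f -> {ae mu, forall x,
  `|nonlin f x| <= nonlin_bound (energy f + 1) + 7 * wderiv f x ^+ 2}.
Proof.
move=> hf; apply: (ae_mono (ae_bound_H1 hf)) => x.
set M := energy f + 1 => fM.
have fX n : `|f x ^+ n| <= M ^+ n by rewrite normrX lerXn2r ?nnegrE// (le_trans _ fM).
have := fX 2%N; have := fX 3%N; have := fX 4%N.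
have := sqr_ge0 (wderiv f x); move: fM; rewrite /nonlin /nonlin_bound !ler_norml; lra.
Qed.

Lemma nonlin_bound_ge0 M : 0 <= M -> 0 <= nonlin_bound M.
Proof. by move=> M0; rewrite !addr_ge0// mulr_ge0// exprn_ge0. Qed.

(** The two parts of [nonlin_le] are integrated differently: the bounded one
    against the mass of the kernel, the integrable one against its supremum. *)
Lemma helmholtz_integrable f x : H1 f ->
  integrableR (fun y => kernel (x - y) * nonlin f y) /\
  \int[mu]_y `|kernel (x - y) * nonlin f y| <=
    nonlin_bound (energy f + 1) * kernel_mass + 7 * energy f.
Proof.
move=> hf; set C := nonlin_bound _.
have hr : integrableR (fun y => C * kernel (x - y) + 7 * wderiv f y ^+ 2).
  apply: integrableRD; apply: integrableRZ; first exact: kernel_shift_integrable.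
  exact: L2_sqr (wderiv_L2 hf).
have le : {ae mu, forall y, `|kernel (x - y) * nonlin f y| <=
    C * kernel (x - y) + 7 * wderiv f y ^+ 2}.
  apply: (ae_mono (nonlin_le hf)) => y; rewrite -/C => H.
  rewrite normrM gtr0_norm ?kernel_gt0//.
  have k0 := kernel_gt0 (x - y); have k1 := kernel_le1 (x - y).
  have w0 := sqr_ge0 (wderiv f y).
  apply: (le_trans (ler_wpM2l (ltW k0) H)); rewrite mulrDr (mulrC _ C) lerD2l.
  by rewrite mulrCA ler_wpM2l// ler_piMl.
have hi : integrableR (fun y => kernel (x - y) * nonlin f y).
  apply: (integrableR_le _ hr le).
  apply: measurable_funM; last exact: nonlin_measurable.
  exact: integrableR_measurable (kernel_shift_integrable x).
split => //.
apply: (@le_trans _ _ (\int[mu]_y (C * kernel (x - y) + 7 * wderiv f y ^+ 2))).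
  by apply: ae_le_Rint => //; exact: integrableR_norm.
rewrite RintD; [|by apply: integrableRZ; exact: kernel_shift_integrable
  |by apply: integrableRZ; exact: L2_sqr (wderiv_L2 hf)].
rewrite !RintZ; [|exact: L2_sqr (wderiv_L2 hf)|exact: kernel_shift_integrable].
rewrite kernel_shift_mass lerD2l ler_wpM2l// /energy lerDr.
exact: Rint_sqr_ge0.
Qed.

Lemma helmholtz_le f x : H1 f -> `|helmholtz_inv (nonlin f) x| <=
  nonlin_bound (energy f + 1) * kernel_mass + 7 * energy f.
Proof.
move=> hf; have [hi le] := helmholtz_integrable x hf.
rewrite /helmholtz_inv normrM ger0_norm//.
have H := le_trans (le_normr_Rintegral measurableT hi) le.
apply: le_trans (ler_wpM2l _ H) _ => //.
by rewrite ler_piMl// ?(le_trans _ H)//; lra.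
Qed.

Lemma helmholtz_continuous f : H1 f -> continuous (helmholtz_inv (nonlin f)).
Proof.
move=> hf x; set K := nonlin_bound (energy f + 1) * kernel_mass + 7 * energy f.
have H x' : `|helmholtz_inv (nonlin f) x - helmholtz_inv (nonlin f) x'| <=
    (expR `|x - x'| - 1) * K.
  have [hi le] := helmholtz_integrable x hf; have [hi' _] := helmholtz_integrable x' hf.
  have E0 : 0 <= expR `|x - x'| - 1 by rewrite subr_ge0 -[X in X <= _](@expR0 R) ler_expR.
  rewrite /helmholtz_inv -mulrBr -RintB// normrM ger0_norm//.
  have H1 : `|\int[mu]_y (kernel (x - y) * nonlin f y - kernel (x' - y) * nonlin f y)| <=
     \int[mu]_y ((expR `|x - x'| - 1) * `|kernel (x - y) * nonlin f y|).
    apply: normr_Rint_le.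
    - exact: integrableR_measurable (integrableRB hi hi').
    - by apply: integrableRZ; exact: integrableR_norm.
    - move=> y; rewrite -mulrBl !normrM mulrA ler_wpM2r//.
      apply: (le_trans (kernel_increment x x' y)).
      by apply: ler_wpM2l => //; exact: ler_norm.
  rewrite RintZ in H1; last exact: integrableR_norm.
  have H2 := le_trans H1 (ler_wpM2l E0 le).
  by apply: le_trans (ler_wpM2l _ H2) _ => //; rewrite ler_piMl// ?(le_trans _ H2)//; lra.
have c0 : (expR `|x - x'| - 1) * K @[x' --> x] --> (expR `|x - x| - 1) * K.
  apply: cvgM; last exact: cvg_cst.
  apply: cvgB; last exact: cvg_cst.
  apply: continuous_cvg; first exact: continuous_expR.
  apply: cvg_norm; apply: cvgB; first exact: cvg_cst.
  exact: cvg_id.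
rewrite subrr normr0 expR0 subrr mul0r in c0.
apply/cvgrPdist_le => e e0; near=> x'.
apply: (le_trans (H x')).
by near: x'; exact: (cvgr_le _ c0).
Unshelve. all: by end_near. Qed.

(** The equation reads u_t = d_x (flux u). *)
Definition flux f (x : R) : R := f x + 7 * f x ^+ 2 - helmholtz_inv (nonlin f) x.

Definition flux_bound (B : R) : R :=
  (B + 1) + 7 * (B + 1) ^+ 2 + (nonlin_bound (B + 1) * kernel_mass + 7 * B).

Lemma flux_measurable f : H1 f -> measurable_fun setT (flux f).
Proof.
move=> hf; have mf := L2_measurable (H1_L2 hf).
apply: measurable_funB; last first.
  by apply: continuous_measurable_fun; exact: helmholtz_continuous.
by apply: measurable_funD => //; apply: measurable_funM => //; exact: measurable_funX.
Qed.

Lemma nonlin_bound_le (M N : R) : 0 <= M -> M <= N -> nonlin_bound M <= nonlin_bound N.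
Proof.
move=> M0 MN; have H n : M ^+ n <= N ^+ n by rewrite lerXn2r// nnegrE// (le_trans M0).
have := H 2%N; have := H 3%N; have := H 4%N; rewrite /nonlin_bound; lra.
Qed.

Lemma flux_le f B : H1 f -> energy f <= B -> {ae mu, forall x, `|flux f x| <= flux_bound B}.
Proof.
move=> hf fB; apply: (ae_mono (ae_bound_H1 hf)) => x fx.
have e0 := energy_ge0 f.
have h1 := helmholtz_le x hf.
have h2 : nonlin_bound (energy f + 1) * kernel_mass <= nonlin_bound (B + 1) * kernel_mass.
  apply: ler_wpM2r; first exact: kernel_mass_ge0.
  by apply: nonlin_bound_le; lra.
have h3 : `|f x| <= B + 1 by lra.
have h4 : `|f x ^+ 2| <= (B + 1) ^+ 2 by rewrite normrX lerXn2r// nnegrE; lra.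
rewrite /flux /flux_bound; move: h1 h3 h4; rewrite !ler_norml; lra.
Qed.

(** The weak derivative is multiplied by s under x |-> s x + c, but it enters
    [nonlin] squared, and the kernel depends on a distance only. *)
Lemma flux_isometry s c f1 f2 : `|s| = 1 -> H1 f1 -> H1 f2 ->
  {ae mu, forall x, f2 x = f1 (s * x + c)} ->
  {ae mu, forall x, flux f2 x = flux f1 (s * x + c)}.
Proof.
move=> s1 h1 h2 f12; have w12 := wderiv_isometry s1 h1 h2 f12.
have ss : s ^+ 2 = 1 by rewrite -(real_normK (num_real s)) s1 expr1n.
(* s ^+ 2 = 1 absorbs the sign of the reflected weak derivative. *)
have n12 : {ae mu, forall x, nonlin f2 x = nonlin f1 (s * x + c)}.
  by apply: (ae_mono2 f12 w12) => x fx wx; rewrite /nonlin fx wx exprMn ss mul1r.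
have H12 x : helmholtz_inv (nonlin f2) x = helmholtz_inv (nonlin f1) (s * x + c).
  rewrite /helmholtz_inv; apply: (congr1 (fun a => 2^-1 * a)).
  rewrite -[RHS](Rint_isometry c s1); last first.
    exact: integrableR_measurable (helmholtz_integrable (s * x + c) h1).1.
  apply: ae_eq_Rint.
  - exact: integrableR_measurable (helmholtz_integrable x h2).1.
  - apply: (@measurable_isometry _ s c (fun y => kernel (s * x + c - y) * nonlin f1 y)).
    exact: integrableR_measurable (helmholtz_integrable (s * x + c) h1).1.
  - apply: (ae_mono n12) => y ->; congr (expR (- _) * _).
    by rewrite (_ : s * x + c - (s * y + c) = s * (x - y)) ?normrM ?s1 ?mul1r//; ring.
by apply: (ae_mono f12) => x fx; rewrite /flux fx H12.
Qed.

End Flux.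

(** * Pairings with moving test functions *)
Section Pairings.
Variable R : realType.
Notation mu := (@lebesgue_measure R).
Implicit Types f g psi F : R -> R.

Let shiftE psi (a : R) : (fun x => psi (x - a)) = (fun x => psi (1 * x + - a)).
Proof. by apply/funext => x; rewrite mul1r. Qed.

Let reflectE psi : (fun x : R => psi (- x)) = (fun x => psi (- 1 * x + 0)).
Proof. by apply/funext => x; rewrite mulN1r addr0. Qed.

Lemma smooth_cpt_shift psi (a : R) : smooth_cpt psi -> smooth_cpt (fun x => psi (x - a)).
Proof. by move=> hp; rewrite shiftE; apply: smooth_cpt_affine => //; exact: oner_neq0. Qed.

Lemma derive1_shift psi (a x : R) : smooth_cpt psi ->
  (fun x => psi (x - a))^`()%classic x = psi^`()%classic (x - a).
Proof.
move=> hp; rewrite shiftE.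
by rewrite (derive1_affine (@smooth_cpt_derivable _ _ hp _)) !mul1r.
Qed.

Lemma smooth_cpt_reflect psi : smooth_cpt psi -> smooth_cpt (fun x => psi (- x)).
Proof.
move=> hp; rewrite reflectE; by apply: smooth_cpt_affine.
Qed.

Lemma derive1_reflect psi (x : R) : smooth_cpt psi ->
  (fun x => psi (- x))^`()%classic x = - psi^`()%classic (- x).
Proof.
move=> hp; rewrite reflectE.
by rewrite (derive1_affine (@smooth_cpt_derivable _ _ hp _)) !mulN1r addr0.
Qed.

Lemma pairing_bounded_integrable F psi (M : R) : measurable_fun setT F -> smooth_cpt psi ->
  {ae mu, forall x, `|F x| <= M} -> integrableR (fun x => F x * psi x).
Proof.
move=> mF hp FM.
apply: (@integrableR_le _ _ (fun x => M * `|psi x|)).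
- by apply: measurable_funM => //; exact: smooth_cpt_measurable.
- by apply: integrableRZ; apply: integrableR_norm; exact: smooth_cpt_integrable.
- by apply: (ae_mono FM) => x Fx; rewrite normrM ler_wpM2r.
Qed.

(** The centres [a] and [b] stay in a bounded set, so that all the test
    functions involved vanish outside a common interval and the constant is
    uniform in [F]. *)
Lemma pairing_lipschitz psi (A : R) : smooth_cpt psi -> exists C, 0 < C /\
  forall F M a b, measurable_fun setT F -> 0 <= M -> {ae mu, forall x, `|F x| <= M} ->
  `|a| <= A -> `|b| <= A ->
  `|\int[mu]_x (F x * (psi (x - b) - psi (x - a)))| <= C * M * `|b - a| /\
  `|\int[mu]_x (F x * (psi (x - b) - psi (x - a) + (b - a) * psi^`()%classic (x - a)))|
    <= C * M * (b - a) ^+ 2.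
Proof.
move=> hp; have hp' := smooth_cpt_derive hp.
have [L [L0 HL]] := smooth_cpt_radius hp; have [L' [L'0 HL']] := smooth_cpt_radius hp'.
have [C1 [C10 H1]] := smooth_cpt_lipschitz hp; have [C2 [C20 H2]] := smooth_cpt_taylor hp.
set r := L + L' + `|A|.
have r0 : 0 <= r by rewrite !addr_ge0// ltW.
exists ((C1 + C2) * (2 * r + 1)); split.
  by apply: mulr_gt0; [exact: addr_gt0|lra].
move=> F M a b mF M0 FM aA bA.
have outside (a' x : R) : `|a'| <= A -> ~~ (- r <= x <= r) ->
    psi (x - a') = 0 /\ psi^`()%classic (x - a') = 0.
  move=> a'A; rewrite -ler_norml -ltNge => rx.
  have H : L + L' <= `|x - a'|.
    have := lerB_dist x a'; have := ler_norm A; have := ltW L0;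
    have := ltW L'0; move: rx; rewrite /r; lra.
  by rewrite HL ?HL'//; lra.
have gen (d : R -> R) (K : R) : measurable_fun setT d -> 0 <= K ->
    (forall x, `|d x| <= K) -> (forall x, ~~ (- r <= x <= r) -> d x = 0) ->
    `|\int[mu]_x (F x * d x)| <= M * K * (2 * r).
  move=> md K0 dK d0.
  have I2 : \int[mu]_x (\1_(`[- r, r]%classic) x : R) = 2 * r.
    by rewrite Rint_indic; lra.
  rewrite -I2 -RintZ; last exact: integrableR_indic.
  apply: ae_normr_Rint_le.
  - exact: measurable_funM.
  - by apply: integrableRZ; exact: integrableR_indic.
  - apply: (ae_mono FM) => x Fx; rewrite indicE01.
    have [_|xr] /= := boolP (- r <= x <= r).
      by rewrite mulr1 normrM ler_pM.
    by rewrite d0// !mulr0 normr0.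
have ms (a' : R) : measurable_fun setT (fun x : R => psi (x - a')).
  exact: smooth_cpt_measurable (smooth_cpt_shift a' hp).
have ms' (a' : R) : measurable_fun setT (fun x : R => psi^`()%classic (x - a')).
  exact: smooth_cpt_measurable (smooth_cpt_shift a' hp').
have C12 : 0 < C1 + C2 by rewrite addr_gt0.
split.
- have := @gen (fun x => psi (x - b) - psi (x - a)) (C1 * `|b - a|).
  move=> /(_ _ _ _ _)/le_trans; apply.
  + exact: measurable_funB.
  + by apply: mulr_ge0 => //; exact: ltW.
  + move=> x; apply: le_trans (H1 _ _) _.
    by rewrite (_ : x - b - (x - a) = - (b - a)) ?normrN//; ring.
  + by move=> x xr; rewrite (outside a x aA xr).1 (outside b x bA xr).1 subrr.
  + have -> : M * (C1 * `|b - a|) * (2 * r) = C1 * (2 * r) * (M * `|b - a|) by ring.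
    have -> : (C1 + C2) * (2 * r + 1) * M * `|b - a| =
        (C1 + C2) * (2 * r + 1) * (M * `|b - a|) by ring.
    by apply: ler_wpM2r; [exact: mulr_ge0|nra].
- have := @gen (fun x => psi (x - b) - psi (x - a) + (b - a) * psi^`()%classic (x - a))
    (C2 * (b - a) ^+ 2).
  move=> /(_ _ _ _ _)/le_trans; apply.
  + by apply: measurable_funD; [exact: measurable_funB|exact: measurable_funM].
  + by apply: mulr_ge0; [exact: ltW|exact: sqr_ge0].
  + move=> x; have := H2 (x - a) (x - b).
    have -> : x - b - (x - a) = - (b - a) by ring.
    by rewrite sqrrN mulrN opprK (mulrC (psi^`()%classic _)).
  + move=> x xr; have [a0 a1] := outside a x aA xr.
    by rewrite a0 a1 (outside b x bA xr).1 subrr mulr0 addr0.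
  + have -> : M * (C2 * (b - a) ^+ 2) * (2 * r) = C2 * (2 * r) * (M * (b - a) ^+ 2) by ring.
    have -> : (C1 + C2) * (2 * r + 1) * M * (b - a) ^+ 2 =
        (C1 + C2) * (2 * r + 1) * (M * (b - a) ^+ 2) by ring.
    by apply: ler_wpM2r; [rewrite mulr_ge0// sqr_ge0|nra].
Qed.

Lemma pairing_dist_le f g psi : H1 f -> H1 g -> smooth_cpt psi ->
  `|\int[mu]_x (f x * psi x) - \int[mu]_x (g x * psi x)| <=
  H1norm (f \- g) * Num.sqrt (\int[mu]_x (psi x ^+ 2)).
Proof.
move=> hf hg hp; have L2f := H1_L2 hf; have L2g := H1_L2 hg.
rewrite -RintB ?L2_mul_test//.
have -> : (fun x => f x * psi x - g x * psi x) = (fun x => (f x - g x) * psi x).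
  by apply/funext => x; rewrite mulrBl.
have P0 : 0 <= \int[mu]_x (psi x ^+ 2) by exact: Rint_sqr_ge0.
rewrite -sqrtrM; last exact: energy_ge0.
rewrite -sqrtr_sqr ler_wsqrtr//.
apply: le_trans (Rint_CauchySchwarz (L2B L2f L2g) (smooth_cpt_L2 hp)) _.
by apply: ler_wpM2r => //; rewrite lerDl Rint_sqr_ge0.
Qed.

(** Reflecting the variable about [l] changes the sign of the integral. *)
Lemma pairing_odd F (theta : R -> R) (l : R) : measurable_fun setT F -> measurable_fun setT theta ->
  {ae mu, forall x, F x = F (2 * l - x)} -> (forall x, theta (- x) = - theta x) ->
  integrableR (fun x => F x * theta (x - l)) ->
  \int[mu]_x (F x * theta (x - l)) = 0.
Proof.
move=> mF mt Fe to hi; set I := Rintegral _ _ _.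
have n1 : `|-1 : R| = 1 by rewrite normrN normr1.
have hi' := integrableR_isometry (2 * l) n1 hi.
have : I = - 1 * I.
  rewrite -RintZ//.
  rewrite -[LHS](Rint_isometry (2 * l) n1); last exact: integrableR_measurable.
  apply: ae_eq_Rint.
  - exact: integrableR_measurable.
  - exact: integrableR_measurable (integrableRZ (- 1) hi).
  - apply: (ae_mono Fe) => x Fx.
    have -> : -1 * x + 2 * l = 2 * l - x by ring.
    rewrite -Fx.
    have -> : 2 * l - x - l = - (x - l) by ring.
    by rewrite to; ring.
lra.
Qed.

Lemma Rint_shift F (c : R) : measurable_fun setT F ->
  \int[mu]_x F (x - c) = \int[mu]_x F x.
Proof.
move=> mF; rewrite -[RHS](Rint_isometry (- c) (normr1 R))//.
by congr Rintegral; apply/funext => x; rewrite mul1r.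
Qed.

Lemma ae_shift (P : R -> Prop) (c : R) :
  {ae mu, forall x, P x} -> {ae mu, forall x, P (x - c)}.
Proof.
move=> /(ae_isometry (- c) (normr1 R)); move/ae_mono; apply => x.
by rewrite mul1r.
Qed.

End Pairings.

(** * Evolution of a pairing with a fixed test function *)
Section Evolution.
Variable R : realType.
Notation mu := (@lebesgue_measure R).
Variable u : R -> R -> R.
Hypothesis hu : weak_solution +oo%E u.
Implicit Types (t e : R) (psi rho : R -> R).

Lemma timesy (t : R) : times +oo%E t <-> 0 <= t.
Proof. by rewrite /times/= ltry; split=> [[]|]. Qed.

Lemma H1_at t : 0 <= t -> H1 (u t).
Proof. by move=> t0; apply: hu.1.1; exact/timesy. Qed.

Lemma H1norm_near t e : 0 <= t -> 0 < e ->
  \forall s \near t, 0 <= s -> H1norm (u s \- u t) < e.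
Proof.
move=> t0 e0; have H := hu.1.2 t (proj2 (timesy t) t0).
have Hn : \forall s \near t, times +oo%E s -> H1norm (u s \- u t) < e.
  exact: (cvgr_lt _ H _ e0).
by apply: filterS Hn => s Hs s0; apply: Hs; exact/timesy.
Qed.

(** Continuity in time with values in H^1, at a single time, makes the energy
    bounded at the neighbouring times. *)
Lemma energy_near t : 0 <= t ->
  exists B, 0 <= B /\ \forall s \near t, 0 <= s -> energy (u s) <= B.
Proof.
move=> t0; exists (2 * energy (u t) + 2); split.
  by rewrite addr_ge0// mulr_ge0// energy_ge0.
apply: filterS (H1norm_near t0 ltr01) => s Hs s0.
apply: le_trans (energy_triangle (H1_at s0) (H1_at t0)) _.
rewrite lerD2l -[leRHS]mulr1 ler_wpM2l// -H1norm_sqr.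
by rewrite expr_le1// ?sqrtr_ge0// ltW// Hs.
Qed.

Lemma pairing_near psi t e : smooth_cpt psi -> 0 <= t -> 0 < e ->
  \forall s \near t, 0 <= s ->
    `|\int[mu]_x (u s x * psi x) - \int[mu]_x (u t x * psi x)| <= e.
Proof.
move=> hp t0 e0; set P := Num.sqrt (\int[mu]_x (psi x ^+ 2)).
have P1 : 0 < P + 1 by rewrite ltr_wpDl// sqrtr_ge0.
apply: filterS (H1norm_near t0 (divr_gt0 e0 P1)) => s Hs s0.
apply: le_trans (pairing_dist_le (H1_at s0) (H1_at t0) hp) _.
have P0 : 0 <= P by exact: sqrtr_ge0.
apply: le_trans (ler_wpM2r P0 (ltW (Hs s0))) _.
by rewrite mulrAC ler_pdivrMr// ler_pM2l//; lra.
Qed.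

Lemma pairing_continuous_at psi t : smooth_cpt psi -> 0 < t ->
  {for t, continuous (fun s => \int[mu]_x (u s x * psi x))}.
Proof.
move=> hp t0; apply/cvgrPdist_le => e e0.
near=> s; rewrite distrC.
have s0 : 0 <= s by apply/ltW; near: s; exact: lt_nbhsr.
by move: s0; near: s; exact: pairing_near (ltW t0) e0.
Unshelve. all: by end_near. Qed.

Lemma flux_pairing_integrable f psi : H1 f -> smooth_cpt psi ->
  integrableR (fun x => flux f x * psi x).
Proof.
move=> hf hp; apply: (pairing_bounded_integrable (flux_measurable hf) hp (flux_le hf (lexx _))).
Qed.

(** Both pairings with [psi] are functions of time alone; the second one is not
    known to be measurable in time. *)
Lemma weak_tensor rho psi (a b : R) : 0 < a -> smooth_cpt rho ->
  (forall t, t < a \/ b < t -> rho t = 0) -> smooth_cpt psi ->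
  \int[mu]_(t in [set t | 0 < t /\ (t%:E < +oo)%E])
    (rho^`()%classic t * \int[mu]_x (u t x * psi x)
      - rho t * \int[mu]_x (flux (u t) x * psi^`()%classic x)) = 0.
Proof.
move=> a0 hr r0 hp; rewrite -[RHS](hu.2 _ (test_function_tensor a0 hr r0 hp)).
apply: eq_Rintegral => t /set_mem/= [t0 _].
have hp' := smooth_cpt_derive hp; have hut := H1_at (ltW t0).
rewrite -!RintZ; [|exact: flux_pairing_integrable|exact: L2_mul_test (H1_L2 hut) hp].
rewrite -RintB; [|by apply: integrableRZ; exact: L2_mul_test (H1_L2 hut) hp
  |by apply: integrableRZ; exact: flux_pairing_integrable].
congr Rintegral; apply/funext => x.
by rewrite !derive_tensor//= /flux; ring.
Qed.

(** The two functions agree outside the windows of width 2 e around [x] and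
    [y]. *)
Lemma step_sub_indic (x y z e : R) : 0 < e -> x <= y ->
  `|step e x z - step e y z - ((x <= z <= y)%R)%:R| <=
    2 * (((x - e <= z <= x + e)%R)%:R + ((y - e <= z <= y + e)%R)%:R).
Proof.
move=> e0 xy; have r1 := step_sub_le e x y z.
have r2 : `|step e x z - step e y z - ((x <= z <= y)%R)%:R| <= 2.
  by move: r1; case: (x <= z <= y) => /=; rewrite !ler_norml; lra.
have [w0|w0] := boolP (x - e <= z <= x + e).
  by apply: (le_trans r2); case: (y - e <= z <= y + e) => /=; lra.
have [w1|w1] := boolP (y - e <= z <= y + e).
  by apply: (le_trans r2); rewrite /=; lra.
have [xyz|xyz] := boolP (x <= z <= y).
  by rewrite step_eq1 ?step_eq0 ?subr0 ?subrr ?normr0 ?addr0 ?mulr0//; lra.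
have [zx|zy] : z <= x - e \/ y + e <= z by have [?|?] := leP z x; [left|right]; lra.
  by rewrite !step_eq0 ?subrr ?normr0 ?addr0 ?mulr0//; lra.
by rewrite !step_eq1 ?subrr ?normr0 ?addr0 ?mulr0//; lra.
Qed.

(** The integrand in time of [weak_tensor] is compared with the integrable
    function F, in which the pairing of the flux is replaced by k and the test
    function in time by an indicator function; Kf bounds the difference. The
    restriction to [a, b] makes the pairing integrable over the line. *)
Lemma mollified_increment psi (a b t0 t1 k K e : R) : smooth_cpt psi ->
  0 < a -> 0 < e -> a <= t0 - e -> t0 <= t1 -> t1 + e <= b ->
  let gc := (fun t => \int[mu]_x (u t x * psi x)) \_ `[a, b]%classic in
  locally_integrable setT gc ->
  (forall t, a <= t <= b ->
    `|\int[mu]_x (flux (u t) x * psi^`()%classic x) - k| <= K) ->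
  `|\int[mu]_t (gc t * bump e t1 t) - \int[mu]_t (gc t * bump e t0 t) + k * (t1 - t0)|
    <= K * (t1 - t0 + 2 * e) + 8 * `|k| * e.
Proof.
move=> hp a0 e0 ea t01 eb gc lgc HK.
pose g t := \int[mu]_x (u t x * psi x).
pose G t := \int[mu]_x (flux (u t) x * psi^`()%classic x).
have K0 : 0 <= K by apply: (le_trans (normr_ge0 _) (HK t0 _)); clear -e0 ea t01 eb; lra.
pose rho t := step e t0 t - step e t1 t.
have hrho : smooth_cpt rho by exact: step_sub_smooth_cpt.
have rho0 t : t < a \/ b < t -> rho t = 0.
  by move=> H; apply: step_sub_eq0 => //; case: H => H; [left|right];
    clear -H ea eb; lra.
have rho' t : rho^`()%classic t = bump e t0 t - bump e t1 t.
  by rewrite /rho derive_step_sub.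
pose J := \1_(`[t0, t1]%classic) : R -> R.
pose J0 := \1_(`[t0 - e, t0 + e]%classic) : R -> R.
pose J1 := \1_(`[t1 - e, t1 + e]%classic) : R -> R.
pose Je := \1_(`[t0 - e, t1 + e]%classic) : R -> R.
have iJ : integrableR J by exact: integrableR_indic.
have iJ0 : integrableR J0 by exact: integrableR_indic.
have iJ1 : integrableR J1 by exact: integrableR_indic.
have iJe : integrableR Je by exact: integrableR_indic.
have IJ : \int[mu]_t J t = t1 - t0 by rewrite Rint_indic.
have IJ0 : \int[mu]_t J0 t = 2 * e by rewrite Rint_indic; clear -e0; lra.
have IJ1 : \int[mu]_t J1 t = 2 * e by rewrite Rint_indic; clear -e0; lra.
have IJe : \int[mu]_t Je t = t1 - t0 + 2 * e by rewrite Rint_indic; clear -e0 t01; lra.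
have EJ t : J t = ((t0 <= t <= t1)%R)%:R by exact: indicE01.
have EJ0 t : J0 t = ((t0 - e <= t <= t0 + e)%R)%:R by exact: indicE01.
have EJ1 t : J1 t = ((t1 - e <= t <= t1 + e)%R)%:R by exact: indicE01.
have EJe t : Je t = ((t0 - e <= t <= t1 + e)%R)%:R by exact: indicE01.
have W := weak_tensor a0 hrho rho0 hp.
clearbody J J0 J1 Je.
rewrite Rintegral_mkcond in W.
pose F t := gc t * bump e t0 t - gc t * bump e t1 t - k * J t.
pose Kf t := K * Je t + 2 * `|k| * (J0 t + J1 t).
have ib0 := locally_integrable_bump t0 e0 lgc.
have ib1 := locally_integrable_bump t1 e0 lgc.
have iF : integrableR F.
  exact: (integrableRB (integrableRB ib0 ib1) (integrableRZ k iJ)).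
have iK : integrableR Kf.
  exact: (integrableRD (integrableRZ K iJe) (integrableRZ (2 * `|k|) (integrableRD iJ0 iJ1))).
have S := @Rint_sandwich _ ((fun t => rho^`()%classic t * g t - rho t * G t)
  \_ [set t | 0 < t /\ (t%:E < +oo)%E]) F Kf iF iK.
have IF : \int[mu]_t F t =
    \int[mu]_t (gc t * bump e t0 t) - \int[mu]_t (gc t * bump e t1 t) - k * (t1 - t0).
  rewrite -IJ -(RintZ k iJ) -(RintB ib0 ib1).
  exact: (RintB (integrableRB ib0 ib1) (integrableRZ k iJ)).
have IK : \int[mu]_t Kf t = K * (t1 - t0 + 2 * e) + 8 * `|k| * e.
  have -> : 8 * `|k| * e = 2 * `|k| * (\int[mu]_t J0 t + \int[mu]_t J1 t).
    by rewrite IJ0 IJ1; ring.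
  rewrite -IJe -(RintZ K iJe) -(RintD iJ0 iJ1) -(RintZ (2 * `|k|) (integrableRD iJ0 iJ1)).
  exact: (RintD (integrableRZ K iJe) (integrableRZ (2 * `|k|) (integrableRD iJ0 iJ1))).
rewrite W IF IK in S.
have swap (x y z : R) : x - y + z = 0 - (y - x - z) by ring.
rewrite [X in `|X| <= _]swap.
apply: S => t; rewrite patchE /F /Kf EJ EJ0 EJ1 EJe.
have k0 := normr_ge0 k.
have [tI|tI] := boolP (t0 - e <= t <= t1 + e); last first.
  have rt : rho t = 0.
    apply: step_sub_eq0 => //; move: tI; rewrite negb_and -!ltNge.
    by move=> /orP[]/ltW; [left|right].
  have b0 : bump e t0 t = 0.
    apply: bump_eq0 => //; rewrite ltNge; apply: contra tI.
    by rewrite ler_distl; clear -e0 t01; lra.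
  have b1 : bump e t1 t = 0.
    apply: bump_eq0 => //; rewrite ltNge; apply: contra tI.
    by rewrite ler_distl; clear -e0 t01; lra.
  have -> : (t0 <= t <= t1) = false.
    by apply: contraNF tI; clear -e0; lra.
  rewrite rho' rt b0 b1 !mulr0 !subr0 !mul0r subr0.
  case: ifP => _; rewrite normr0;
    by rewrite addr_ge0// !mulr_ge0// addr_ge0.
have tab : a <= t <= b by clear -tI ea eb; lra.
have t00 : 0 < t by clear -tab a0; lra.
rewrite ifT; last by rewrite inE/= ltry.
have gct : gc t = g t by rewrite /gc patchE ifT// inE/= in_itv.
have Gt : `|G t - k| <= K by exact: HK.
have r1 : `|rho t| <= 1 by exact: step_sub_le.
have rJ := step_sub_indic t e0 t01; rewrite -/(rho t) in rJ.
rewrite gct rho'.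
have -> : (bump e t0 t - bump e t1 t) * g t - rho t * G t -
   (g t * bump e t0 t - g t * bump e t1 t - k * ((t0 <= t <= t1)%R)%:R) =
   - (rho t * (G t - k)) - k * (rho t - ((t0 <= t <= t1)%R)%:R).
  by move: (bump e t0 t) (bump e t1 t) (rho t) (g t) (G t) => *; ring.
apply: le_trans (ler_normB _ _) _; rewrite normrN !normrM mulr1.
apply: lerD; last by rewrite (mulrC 2) -mulrA ler_wpM2l.
by rewrite -[leRHS]mul1r ler_pM.
Qed.

(** An integrated form of d/dt <u, psi> = - <flux u, psi'>, in which the
    right-hand side is only assumed to be close to the constant - k. The test
    function in time is a difference of two steps at [t0] and [t1]: its
    derivative is a difference of bumps, which recovers the values of the
    continuous function <u, psi> at both ends. *)
Lemma pairing_increment psi (a b t0 t1 k K : R) : smooth_cpt psi ->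
  0 < a -> a < t0 -> t0 <= t1 -> t1 < b ->
  (forall t, a <= t <= b ->
    `|\int[mu]_x (flux (u t) x * psi^`()%classic x) - k| <= K) ->
  `|\int[mu]_x (u t1 x * psi x) - \int[mu]_x (u t0 x * psi x) + k * (t1 - t0)|
    <= K * (t1 - t0).
Proof.
move=> hp a0 at0 t01 t1b HK.
pose g t := \int[mu]_x (u t x * psi x).
pose gc := g \_ `[a, b]%classic.
have cg t : 0 < t -> {for t, continuous g} by exact: pairing_continuous_at.
have igc : integrableR gc.
  have : mu.-integrable `[a, b]%classic (EFin \o g).
    apply: continuous_compact_integrable; first exact: segment_compact.
    apply: continuous_in_subspaceT => t /set_mem/=; rewrite in_itv/= => /andP[ta _].
    by apply: cg; lra.
  by move/integrable_mkcond; rewrite restrict_EFin; apply.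
have lgc : locally_integrable setT gc.
  by apply: open_integrable_locally; [exact: openT|exact: igc].
have pt t : a < t -> t < b -> gc t = g t /\ lebesgue_pt gc t.
  move=> ta tb; split.
    by rewrite /gc patchE ifT// inE/= in_itv/=; lra.
  apply: (@continuous_lebesgue_pt _ _ _ setT) => //.
  - by split; [exact: openT|].
  - exact: integrableR_measurable.
  - have E : \forall s \near t, g s = gc s.
      near=> s; rewrite /gc patchE ifT// inE/= in_itv/=.
      apply/andP; split; apply/ltW; near: s; [exact: lt_nbhsr|exact: lt_nbhsl].
    rewrite /prop_for /continuous_at; have -> : gc t = g t by exact: esym (nbhs_singleton E).
    apply: cvg_trans (cg t _); last lra.
    exact: near_eq_cvg.
have [gt0 lt0] : gc t0 = g t0 /\ lebesgue_pt gc t0 by apply: pt; lra.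
have [gt1 lt1] : gc t1 = g t1 /\ lebesgue_pt gc t1 by apply: pt; lra.
have c0 := bump_cvg lgc lt0; have c1 := bump_cvg lgc lt1.
rewrite gt0 in c0; rewrite gt1 in c1.
have c01 : `|\int[mu]_t (gc t * bump e t1 t) - \int[mu]_t (gc t * bump e t0 t) + k * (t1 - t0)|
    @[e --> 0^'+] --> `|g t1 - g t0 + k * (t1 - t0)|.
  by apply: cvg_norm; apply: cvgD; [exact: cvgB|exact: cvg_cst].
have cR : K * (t1 - t0 + 2 * e) + 8 * `|k| * e @[e --> 0^'+] --> K * (t1 - t0).
  rewrite -[X in _ --> X]addr0 -[X in _ --> _ + X](mulr0 (8 * `|k|)).
  rewrite -[in X in _ --> K * X + _](addr0 (t1 - t0)) -[X in _ --> K * (_ + X) + _](mulr0 2).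
  have cid : e @[e --> (0 : R)^'+] --> (0 : R) by exact: cvg_at_right_filter.
  apply: cvgD; (apply: cvgM; first exact: cvg_cst) => //.
  apply: cvgD; first exact: cvg_cst.
  by apply: cvgM => //; exact: cvg_cst.
apply: (ler_cvg_to c01 cR); near=> e.
have e0 : 0 < e by near: e; exact: nbhs_right_gt.
have ea : e < t0 - a by near: e; apply: nbhs_right_lt; rewrite subr_gt0.
have eb : e < b - t1 by near: e; apply: nbhs_right_lt; rewrite subr_gt0.
by apply: mollified_increment => //; [clear -ea; lra|clear -eb; lra].
Unshelve. all: by end_near. Qed.

End Evolution.

(** * Three facts of calculus *)
Section Calculus.
Variable R : realType.
Implicit Types (f m q : R -> R) (t x : R).

Lemma derivable_lipschitz_at f x : derivable f x 1 ->
  exists L, 0 < L /\ \forall y \near x, `|f y - f x| <= L * `|y - x|.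
Proof.
move=> df; set l := 'D_1 f x.
have H : h^-1 *: ((f \o shift x) (h *: 1) - f x) @[h --> 0^'] --> l by exact: df.
exists (`|l| + 1); split; first by rewrite ltr_wpDl.
move/cvgrPdist_le : H => /(_ 1 ltr01)[r /= r0 Hr].
exists r => //= y /=; rewrite distrC => yr.
have [->|yx] := eqVneq y x; first by rewrite !subrr normr0 mulr0.
have yx0 : y - x != 0 by rewrite subr_eq0.
have := Hr (y - x); rewrite /= sub0r normrN => /(_ yr yx0).
rewrite /GRing.scale/= mulr1 subrK => Hl.
have -> : f y - f x = (y - x)^-1 * (f y - f x) * (y - x) by field.
rewrite normrM ler_wpM2r//.
by have := lerB_dist ((y - x)^-1 * (f y - f x)) l; rewrite distrC in Hl; lra.
Qed.

(** Continuity of [q] is enough because the other factor vanishes at [x]. *)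
Lemma is_derive_mul_vanish m q x (dm : R) : m x = 0 -> is_derive x 1 m dm ->
  {for x, continuous q} -> is_derive x 1 (fun t => m t * q t) (dm * q x).
Proof.
move=> mx [dfm <-] cq.
have H : h^-1 *: ((m \o shift x) (h *: 1) - m x) @[h --> 0^'] --> 'D_1 m x by exact: dfm.
have cq' : q (h + x) @[h --> 0^'] --> q x.
  have c0 : h + x @[h --> (0 : R)^'] --> x.
    have c : h + x @[h --> (0 : R)] --> 0 + x.
      by apply: cvgD; [exact: cvg_id|exact: cvg_cst].
    by rewrite add0r in c; exact: cvg_within_filter c.
  exact: (cvg_comp _ _ c0 cq).
suff K : h^-1 *: (((fun t => m t * q t) \o shift x) (h *: 1) - m x * q x)
    @[h --> 0^'] --> 'D_1 m x * q x.
  split; first by apply/cvg_ex; exists ('D_1 m x * q x).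
  exact: (cvg_lim _ K).
have E : (fun h => h^-1 *: (((fun t => m t * q t) \o shift x) (h *: 1) - m x * q x)) =
    (fun h => h^-1 *: ((m \o shift x) (h *: 1) - m x) * q (h + x)).
  by apply/funext => h; rewrite /= /GRing.scale/= mulr1 mx mul0r !subr0 mulrA.
by rewrite E; apply: cvgM.
Qed.

Lemma derive0_cst_pos f : (forall t, 0 < t -> is_derive t 1 f 0) ->
  forall s t, 0 < s -> 0 < t -> f s = f t.
Proof.
move=> df s t; wlog st : s t / s <= t.
  by move=> H s0 t0; have [/H->|/ltW/H->] := leP s t.
move=> s0 t0; apply/eqP; rewrite eq_sym -subr_eq0; apply/eqP.
have [c _ ->] : exists2 c, c \in `[s, t] & f t - f s = (cst 0 : R -> R) c * (t - s).
  apply: MVT_segment => //.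
    by move=> c; rewrite in_itv/= => /andP[sc _]; apply: df; exact: lt_trans sc.
  apply: continuous_in_subspaceT => c /set_mem/=; rewrite in_itv/= => /andP[sc _].
  apply/differentiable_continuous/derivable1_diffP.
  by have [] := df c (lt_le_trans s0 sc).
by rewrite /= mul0r.
Qed.

End Calculus.

(** * Evolution of a pairing that follows the axis *)
Section KeyDerivative.
Variable R : realType.
Notation mu := (@lebesgue_measure R).
Implicit Types (psi : R -> R).

(** Since [lam] is only differentiable, rho(t) psi(x - lam t) is not an
    admissible test function. The pairing is split instead as g - m q + r:
    g pairs [u t] with the test function frozen at [lam t0], and its derivative
    is given by [pairing_increment]; m = lam t - lam t0 and q form the
    first-order term of the Taylor expansion of [psi]; r is the remainder.
    That the pairing of the flux following the axis is a constant [k] is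
    what makes the frozen pairing of the flux k + O(|t - t0|). *)
Lemma shifted_pairing_derive (u : R -> R -> R) (lam : R -> R) (t0 k : R) psi :
  weak_solution +oo%E u -> 0 < t0 -> derivable lam t0 1 -> smooth_cpt psi ->
  (forall t, 0 < t -> \int[mu]_x (flux (u t) x * psi^`()%classic (x - lam t)) = k) ->
  is_derive t0 1 (fun t => \int[mu]_x (u t x * psi (x - lam t)))
    (- k - 'D_1 lam t0 * \int[mu]_x (u t0 x * psi^`()%classic (x - lam t0))).
Proof.
move=> hu t00 dlam hp Gk; have hp' := smooth_cpt_derive hp.
have hs := smooth_cpt_shift (lam t0) hp; have hs' := smooth_cpt_shift (lam t0) hp'.
have [L [L0 HL]] := derivable_lipschitz_at dlam.
have [B [B0 HB]] := energy_near hu (ltW t00).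
set A := `|lam t0| + 1.
have [C [C0 HC]] := pairing_lipschitz A hp.
have [C' [C'0 HC']] := pairing_lipschitz A hp'.
have aA : `|lam t0| <= A by rewrite lerDl.
have near0 : \forall t \near t0, [/\ 0 < t, energy (u t) <= B,
    `|lam t - lam t0| <= L * `|t - t0| & `|lam t| <= A].
  near=> t; have tp : 0 < t by near: t; exact: lt_nbhsr.
  have lt : `|lam t - lam t0| <= L * `|t - t0| by near: t.
  split => //; first by move: (ltW tp); near: t.
  have : L * `|t - t0| <= 1.
    rewrite mulrC -ler_pdivlMr// mul1r distrC; near: t.
    by apply: (@cvgr_dist_le _ _ _ _ _ id t0) => //; rewrite invr_gt0.
  have := lerB_dist (lam t) (lam t0); rewrite /A; lra.
have [d /= d0 Hd] := near0.
have {}Hd t : `|t - t0| < d -> [/\ 0 < t, energy (u t) <= B,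
    `|lam t - lam t0| <= L * `|t - t0| & `|lam t| <= A].
  by move=> td; apply: Hd; rewrite /= distrC.
pose M := flux_bound B.
have M0 : 0 <= M.
  have B1 : 0 <= B + 1 by rewrite addr_ge0.
  have n := mulr_ge0 (nonlin_bound_ge0 B1) (kernel_mass_ge0 R).
  by have := sqr_ge0 (B + 1); rewrite /M /flux_bound; lra.
pose g t := \int[mu]_x (u t x * psi (x - lam t0)).
pose q t := \int[mu]_x (u t x * psi^`()%classic (x - lam t0)).
pose r t := \int[mu]_x (u t x * (psi (x - lam t) - psi (x - lam t0) +
   (lam t - lam t0) * psi^`()%classic (x - lam t0))).
have dg : is_derive t0 1 g (- k).
  apply: (@is_derive_quadratic _ _ _ _ (2 * C' * M * L)).
  exists (d / 3) => /=; first by rewrite divr_gt0.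
  move=> t /=; rewrite distrC => td.
  have [->|tt0] := eqVneq t t0; first by rewrite !subrr mulr0 subrr normr0 expr2 !mulr0.
  set e := `|t - t0| in td *.
  have e0 : 0 < e by rewrite normr_gt0 subr_eq0.
  have Gnear s : `|s - t0| <= 2 * e ->
      `|\int[mu]_x (flux (u s) x * (fun x => psi (x - lam t0))^`()%classic x) - k|
      <= 2 * C' * M * L * e.
    move=> se; have [s0 sB sL sA] : [/\ 0 < s, energy (u s) <= B,
      `|lam s - lam t0| <= L * `|s - t0| & `|lam s| <= A] by apply: Hd; lra.
    have h1 := H1_at hu (ltW s0).
    have hss := smooth_cpt_shift (lam s) hp'.
    rewrite -(Gk s s0).
    have -> : (fun x => flux (u s) x * (fun x => psi (x - lam t0))^`()%classic x) =
        (fun x => flux (u s) x * psi^`()%classic (x - lam t0)).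
      by apply/funext => x; rewrite derive1_shift.
    rewrite -RintB; [|exact: flux_pairing_integrable h1 hs'
      |exact: flux_pairing_integrable h1 hss].
    have [+ _] := HC' _ _ _ _ (flux_measurable h1) M0 (flux_le h1 sB) sA aA.
    under eq_fun do rewrite mulrBr.
    move=> /le_trans; apply; rewrite distrC.
    have -> : 2 * C' * M * L * e = C' * M * (L * (2 * e)) by ring.
    apply: ler_wpM2l; first by rewrite mulr_ge0// ltW.
    by apply: (le_trans sL); apply: ler_wpM2l => //; exact: ltW.
  (* The time interval used below starts at t0 - 2 e at the earliest. *)
  have t3 : 0 < t0 - e - e.
    have [] : [/\ 0 < t0 - 2 * e, energy (u (t0 - 2 * e)) <= B,
      `|lam (t0 - 2 * e) - lam t0| <= L * `|(t0 - 2 * e) - t0| & `|lam (t0 - 2 * e)| <= A].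
      apply: Hd; rewrite (_ : _ - _ - _ = - (2 * e)); last by ring.
      by rewrite normrN gtr0_norm; clear -e0 td; lra.
    by clear -e0; lra.
  rewrite -real_normK ?num_real// -/e expr2 mulrA mulNr opprK.
  have [tt|tt] := leP t0 t.
    have eE : e = t - t0 by rewrite /e ger0_norm// subr_ge0.
    have := @pairing_increment _ _ hu _ (t0 - e) (t + e) t0 t k (2 * C' * M * L * e) hs.
    rewrite -/(g _) -/(g _) -eE; apply; try by clear -e0 t3 tt; lra.
    by move=> s /andP[sa sb]; apply: Gnear; rewrite ler_norml; clear -sa sb e0 eE; lra.
  have eE : e = t0 - t by rewrite /e ltr0_norm ?subr_lt0// opprB.
  have := @pairing_increment _ _ hu _ (t - e) (t0 + e) t t0 k (2 * C' * M * L * e) hs.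
  rewrite -/(g _) -/(g _) -eE => H.
  have -> : g t - g t0 + k * (t - t0) = - (g t0 - g t + k * e) by rewrite eE; ring.
  rewrite normrN; apply: H; try by clear -e0 t3 tt eE; lra.
  by move=> s /andP[sa sb]; apply: Gnear; rewrite ler_norml; clear -sa sb e0 eE; lra.
have rt0 : r t0 = 0.
  rewrite /r subrr; under eq_fun do rewrite subrr mul0r addr0 mulr0.
  by rewrite Rintegral_cst// mul0r.
have dr : is_derive t0 1 r 0.
  apply: (@is_derive_quadratic _ _ _ _ (C * (B + 1) * L ^+ 2)).
  exists d => //= t /=; rewrite distrC => /Hd[tp tB tL tA].
  rewrite rt0 subr0 mul0r subr0.
  have h1 := H1_at hu (ltW tp).
  have bd : {ae mu, forall x, `|u t x| <= B + 1}.
    by apply: (ae_mono (ae_bound_H1 h1)) => x; lra.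
  have B1 : 0 <= B + 1 by rewrite addr_ge0.
  have [_ /le_trans] := HC _ _ _ _ (L2_measurable (H1_L2 h1)) B1 bd aA tA.
  apply; rewrite -[leRHS]mulrA; apply: ler_wpM2l; first by rewrite mulr_ge0// ltW.
  by rewrite -exprMn -real_normK ?num_real// -(real_normK (num_real (L * _))) lerXn2r
    ?nnegrE// normrM (gtr0_norm L0).
have dm : is_derive t0 1 (fun t => lam t - lam t0) ('D_1 lam t0).
  have := is_deriveB (derivableP dlam) (is_derive_cst (lam t0) t0 1).
  by rewrite subr0.
have dmq := @is_derive_mul_vanish _ (fun t => lam t - lam t0) q t0 ('D_1 lam t0)
  (subrr (lam t0)) dm (pairing_continuous_at hu hs' t00).
have H := is_deriveD (is_deriveB dg dmq) dr.
rewrite addr0 in H.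
apply: near_eq_is_derive H.
near=> t; have tp : 0 < t by near: t; exact: lt_nbhsr.
have L2u := H1_L2 (H1_at hu (ltW tp)).
have hst := smooth_cpt_shift (lam t) hp.
have i1 := L2_mul_test L2u hs; have i2 := L2_mul_test L2u hst.
have i3 := integrableRZ (lam t - lam t0) (L2_mul_test L2u hs').
have E : r t = \int[mu]_x (u t x * psi (x - lam t)) - g t + (lam t - lam t0) * q t.
  rewrite /g /q -(RintZ _ (L2_mul_test L2u hs')) -(RintB i2 i1).
  rewrite -(RintD (integrableRB i2 i1) i3).
  by congr Rintegral; apply/funext => x; ring.
change (g t - (lam t - lam t0) * q t + r t = \int[mu]_x (u t x * psi (x - lam t))).
rewrite E; move: (g t) (q t) (\int[mu]_x _) => a b c; ring.
Unshelve. all: by end_near. Qed.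

End KeyDerivative.

(** * Symmetric solutions *)
Section Symmetric.
Variable R : realType.
Notation mu := (@lebesgue_measure R).
Implicit Types (psi : R -> R).

(** In the frame of the axis the solution is even and does not depend on time:
    against an even test function the flux term and the transport term of
    [shifted_pairing_derive] are pairings of an even function with an odd one,
    hence vanish, so these pairings are constant; and an even profile is
    determined by its pairings with even test functions. *)
Lemma symmetric_profile (u : R -> R -> R) (lam : R -> R) :
  weak_solution +oo%E u -> (forall t, 0 < t -> derivable lam t 1) ->
  (forall t, 0 < t -> {ae mu, forall x, u t x = u t (2 * lam t - x)}) ->
  exists w, H1 w /\ forall t, 0 < t -> {ae mu, forall x, u t x = w (x - lam t)}.
Proof.
move=> hu dlam sym.
have n1 : `|-1 : R| = 1 by rewrite normrN normr1.
have hH t : 0 < t -> H1 (u t) by move=> /ltW; exact: H1_at.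
pose w t x := u t (1 * x + lam t).
have hw t : 0 < t -> H1 (w t) by move=> t0; exact: H1_isometry (normr1 R) (hH t t0).
have pw t psi : 0 < t -> smooth_cpt psi ->
    \int[mu]_x (w t x * psi x) = \int[mu]_x (u t x * psi (x - lam t)).
  move=> t0 hp.
  have m := integrableR_measurable (L2_mul_test (H1_L2 (hH t t0)) (smooth_cpt_shift (lam t) hp)).
  rewrite -[RHS](Rint_isometry (lam t) (normr1 R) m).
  by congr Rintegral; apply/funext => x; rewrite /w mul1r addrK.
have weven t : 0 < t -> {ae mu, forall x, w t x = w t (- 1 * x + 0)}.
  move=> t0; apply: (ae_mono (ae_isometry (lam t) (normr1 R) (sym t t0))) => x.
  by rewrite /w => ->; congr (u t _); ring.
(* Even test functions: both terms of the derivative vanish. *)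
have even_cst psi s t : smooth_cpt psi -> (forall x, psi (- x) = psi x) -> 0 < s -> 0 < t ->
    \int[mu]_x (w s x * psi x) = \int[mu]_x (w t x * psi x).
  move=> hp ep s0 t0; rewrite !pw//.
  have hp' := smooth_cpt_derive hp.
  have op x : psi^`()%classic (- x) = - psi^`()%classic x.
    have := derive1_reflect x hp; have -> : (fun y => psi (- y)) = psi by exact/funext.
    by move=> ->; rewrite opprK.
  have mp := smooth_cpt_measurable hp'.
  pose h r := \int[mu]_x (u r x * psi (x - lam r)).
  rewrite -/(h s) -/(h t); apply: derive0_cst_pos => // r r0.
  have hs' := smooth_cpt_shift (lam r) hp'.
  have H := @shifted_pairing_derive _ u lam r 0 psi hu r0 (dlam r r0) hp.
  rewrite (_ : 0 = - 0 - 'D_1 lam r * \int[mu]_x (u r x * psi^`()%classic (x - lam r))).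
    apply: H => y y0; apply: pairing_odd => //.
    - exact: flux_measurable (hH y y0).
    - have E x : - 1 * x + 2 * lam y = 2 * lam y - x by ring.
      have us : {ae mu, forall x, u y x = u y (- 1 * x + 2 * lam y)}.
        by apply: (ae_mono (sym y y0)) => x; rewrite E.
      by apply: (ae_mono (flux_isometry n1 (hH y y0) (hH y y0) us)) => x; rewrite E.
    - exact: flux_pairing_integrable (hH y y0) (smooth_cpt_shift (lam y) hp').
  rewrite (@pairing_odd _ (u r) psi^`()%classic (lam r)) ?mulr0 ?subr0 ?oppr0//.
  - exact: L2_measurable (H1_L2 (hH r r0)).
  - exact: sym.
  - exact: L2_mul_test (H1_L2 (hH r r0)) hs'.
(* An arbitrary test function has the same pairing with an even profile as
   its even part. *)
have all_cst psi s t : smooth_cpt psi -> 0 < s -> 0 < t ->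
    \int[mu]_x (w s x * psi x) = \int[mu]_x (w t x * psi x).
  move=> hp s0 t0; have hr := smooth_cpt_reflect hp.
  have refl r : 0 < r -> \int[mu]_x (w r x * psi (- x)) = \int[mu]_x (w r x * psi x).
    move=> r0; have i1 := L2_mul_test (H1_L2 (hw r r0)) hp.
    have m1 := integrableR_measurable i1.
    rewrite -[RHS](Rint_isometry 0 n1 m1); apply: ae_eq_Rint.
    - exact: integrableR_measurable (L2_mul_test (H1_L2 (hw r r0)) hr).
    - exact: (@measurable_isometry _ (- 1) 0 _ m1).
    - by apply: (ae_mono (weven r r0)) => x <-; rewrite mulN1r addr0.
  have hsum := smooth_cptD hp hr.
  have esum r : 0 < r -> \int[mu]_x (w r x * (psi x + psi (- x))) =
      2 * \int[mu]_x (w r x * psi x).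
    move=> r0; under eq_fun do rewrite mulrDr.
    rewrite RintD; [|exact: L2_mul_test (H1_L2 (hw r r0)) hp
      |exact: L2_mul_test (H1_L2 (hw r r0)) hr].
    by rewrite refl// mulr_natl mulr2n.
  have := even_cst _ s t hsum _ s0 t0; rewrite !esum// => H.
  apply: (mulfI (_ : (2 : R) != 0)) => //; apply: H => x.
  by rewrite opprK addrC.
exists (w 1); split; first exact: hw.
move=> t t0.
have wt : {ae mu, forall x, w t x - w 1 x = 0}.
  apply: L2_test_eq0.
    by apply: L2B; apply: H1_L2; apply: hw.
  move=> psi hp; under eq_fun do rewrite mulrBl.
  rewrite RintB; [|exact: L2_mul_test (H1_L2 (hw t t0)) hp
    |exact: L2_mul_test (H1_L2 (hw 1 ltr01)) hp].
  by rewrite (all_cst psi t 1)// subrr.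
apply: (ae_mono (ae_shift (lam t) wt)) => x /eqP; rewrite subr_eq0 => /eqP <-.
by rewrite /w mul1r subrK.
Qed.

(** Once the profile is fixed, the pairing that follows the axis is constant for
    every test function, and so is that of the flux; the derivative of the
    former, computed by [shifted_pairing_derive], is therefore zero. *)
Lemma profile_speed (u : R -> R -> R) (lam : R -> R) (w : R -> R) (t : R) psi :
  weak_solution +oo%E u -> (forall t, 0 < t -> derivable lam t 1) -> H1 w ->
  (forall t, 0 < t -> {ae mu, forall x, u t x = w (x - lam t)}) ->
  0 < t -> smooth_cpt psi ->
  'D_1 lam t * \int[mu]_x (w x * psi^`()%classic x) =
    - \int[mu]_x (flux w x * psi^`()%classic x).
Proof.
move=> hu dlam hw uw t0 hp; have hp' := smooth_cpt_derive hp.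
have hH s : 0 < s -> H1 (u s) by move=> /ltW; exact: H1_at.
have shift_pair s (F G : R -> R) (theta : R -> R) :
    measurable_fun setT F -> measurable_fun setT G ->
    smooth_cpt theta -> {ae mu, forall x, G x = F (x - lam s)} ->
    \int[mu]_x (G x * theta (x - lam s)) = \int[mu]_x (F x * theta x).
  move=> mF mG ht FG; have mt := smooth_cpt_measurable ht.
  rewrite -[RHS](@Rint_shift _ _ (lam s)); last exact: measurable_funM.
  apply: ae_eq_Rint.
  - by apply: measurable_funM => //; exact: smooth_cpt_measurable (smooth_cpt_shift (lam s) ht).
  - have := @measurable_isometry _ 1 (- lam s) _ (measurable_funM mF mt).
    by under eq_fun do rewrite mul1r.
  - by apply: (ae_mono FG) => x ->.
have mw := L2_measurable (H1_L2 hw).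
have mu_ s : 0 < s -> measurable_fun setT (u s).
  by move=> s0; exact: L2_measurable (H1_L2 (hH s s0)).
have fluxE s : 0 < s -> {ae mu, forall x, flux (u s) x = flux w (x - lam s)}.
  move=> s0; have E x : 1 * x + - lam s = x - lam s by rewrite mul1r.
  have us : {ae mu, forall x, u s x = w (1 * x + - lam s)}.
    by apply: (ae_mono (uw s s0)) => x; rewrite E.
  by apply: (ae_mono (flux_isometry (normr1 R) hw (hH s s0) us)) => x; rewrite E.
have H := @shifted_pairing_derive _ u lam t (\int[mu]_x (flux w x * psi^`()%classic x)) psi
  hu t0 (dlam t t0) hp.
have {}H := H (fun s s0 => shift_pair s _ _ _ (flux_measurable hw)
  (flux_measurable (hH s s0)) hp' (fluxE s s0)).
rewrite (shift_pair t _ _ _ mw (mu_ t t0) hp' (uw t t0)) in H.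
have Hc : is_derive t 1 (fun s => \int[mu]_x (u s x * psi (x - lam s))) 0.
  apply: (@near_eq_is_derive _ _ _ (cst (\int[mu]_x (w x * psi x)))).
  near=> s; have s0 : 0 < s by near: s; exact: lt_nbhsr.
  by rewrite /= (shift_pair s _ _ _ mw (mu_ s s0) hp (uw s s0)).
have [_ e1] := H; have [_ e2] := Hc; rewrite e1 in e2.
by apply/eqP; rewrite -subr_eq0 opprK addrC; apply/eqP; rewrite -[RHS]oppr0 -e2; ring.
Unshelve. all: by end_near. Qed.

(** By [profile_speed] the speed of the axis is a quotient independent of time
    as soon as some pairing of [w] with a [psi^`()] is nonzero; otherwise [w]
    has zero weak derivative and vanishes, and any speed is suitable. *)
Lemma affine_axis (u : R -> R -> R) (lam : R -> R) (w : R -> R) :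
  weak_solution +oo%E u -> (forall t, 0 < t -> derivable lam t 1) -> H1 w ->
  (forall t, 0 < t -> {ae mu, forall x, u t x = w (x - lam t)}) ->
  exists c b, forall t, 0 < t -> {ae mu, forall x, u t x = w (x - (c * t + b))}.
Proof.
move=> hu dlam hw uw.
have [[psi [hp A0]]|H] := pselect (exists psi, smooth_cpt psi /\
    \int[mu]_x (w x * psi^`()%classic x) <> 0).
- set A := Rintegral _ _ _ in A0.
  have /eqP A0' := A0.
  pose c := - (\int[mu]_x (flux w x * psi^`()%classic x)) / A.
  have lam' t : 0 < t -> 'D_1 lam t = c.
    move=> t0; rewrite /c -(profile_speed hu dlam hw uw t0 hp) -/A.
    by rewrite mulfK.
  exists c, (lam 1 - c * 1) => t t0.
  have -> : c * t + (lam 1 - c * 1) = lam t.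
    have dpos (s : R) : 0 < s -> is_derive s 1 (fun t => lam t - (c * t + 0)) 0.
      move=> s0; have := is_deriveB (derivableP (dlam s s0)) (is_derive_affine c 0 s).
      by rewrite lam'// subrr.
    have := derive0_cst_pos dpos t0 ltr01.
    by rewrite !addr0 => <-; ring.
  exact: uw.
- have w0 : {ae mu, forall x, w x = 0}.
    apply: weak_derivative0; first exact: H1_L2.
    apply/weak_derivativeP => psi hp.
    have -> : (fun x => cst 0 x * psi x) = cst (0 : R).
      by apply/funext => x; rewrite /= mul0r.
    rewrite Rintegral_cst// mul0r oppr0; apply: contrapT => A0.
    by apply: H; exists psi.
  exists 0, 0 => t t0.
  apply: (ae_mono2 (uw t t0) (ae_mono2 (ae_shift (lam t) w0) (ae_shift (0 * t + 0) w0)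
    (fun x a b => conj a b))) => x -> [-> ->] //.
Qed.

(** Pairings with a fixed test function are continuous up to t = 0, and so are
    those of the moving profile. *)
Lemma profile_initial (u : R -> R -> R) (w : R -> R) (c b : R) :
  weak_solution +oo%E u -> H1 w ->
  (forall t, 0 < t -> {ae mu, forall x, u t x = w (x - (c * t + b))}) ->
  {ae mu, forall x, u 0 x = w (x - b)}.
Proof.
move=> hu hw uw; have h0 := H1_at hu (lexx 0).
have hwb : H1 (fun x => w (x - b)).
  have := H1_isometry (- b) (normr1 R) hw.
  by under eq_fun do rewrite mul1r.
suff : {ae mu, forall x, u 0 x - w (x - b) = 0}.
  by move/ae_mono; apply => x /eqP; rewrite subr_eq0 => /eqP.
apply: L2_test_eq0; first exact: L2B (H1_L2 h0) (H1_L2 hwb).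
move=> psi hp; under eq_fun do rewrite mulrBl.
rewrite RintB; [|exact: L2_mul_test (H1_L2 h0) hp|exact: L2_mul_test (H1_L2 hwb) hp].
have mw := L2_measurable (H1_L2 hw).
have shiftE a : \int[mu]_x (w (x - a) * psi x) = \int[mu]_x (w x * psi (x - - a)).
  have m : measurable_fun setT (fun x => w x * psi (x - - a)).
    exact: integrableR_measurable (L2_mul_test (H1_L2 hw) (smooth_cpt_shift (- a) hp)).
  rewrite -[RHS](Rint_shift a m).
  by congr Rintegral; apply/funext => x; rewrite opprK subrK.
have [C [C0 HC]] := pairing_lipschitz (`|b| + `|c|) hp.
pose M := energy w + 1.
have M0 : 0 <= M by rewrite addr_ge0// energy_ge0.
apply/eqP; rewrite subr_eq0; apply/eqP.
(* A time t so small that both u t is close to u 0 and the profile has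
   moved little, each within e / 2. *)
apply/eqP; rewrite -subr_eq0 -normr_le0; apply/ler_addgt0Pr => e e0; rewrite add0r.
have CM : 0 < C * M * `|c| + 1 by rewrite ltr_wpDl// !mulr_ge0// ltW.
have [d /= d0 Hd] := pairing_near hu hp (lexx 0) (divr_gt0 e0 (ltr0n R 2)).
pose t := Num.min (Num.min 1 (d / 2)) (e / 2 / (C * M * `|c| + 1)).
have t0 : 0 < t by rewrite !lt_min ltr01 !divr_gt0.
have t1 : t <= 1 by rewrite /t !ge_min lexx.
have td : t < d.
  by apply: (@le_lt_trans _ _ (d / 2)); [rewrite /t !ge_min lexx orbT|lra].
have te : t * (C * M * `|c| + 1) <= e / 2.
  by rewrite -ler_pdivlMr// /t !ge_min lexx !orbT.
have := Hd t; rewrite /= sub0r normrN gtr0_norm// => /(_ td (ltW t0)) H1.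
have ut : \int[mu]_x (u t x * psi x) = \int[mu]_x (w x * psi (x - - (c * t + b))).
  rewrite -shiftE; apply: ae_eq_Rint.
  - exact: integrableR_measurable (L2_mul_test (H1_L2 (H1_at hu (ltW t0))) hp).
  - apply: measurable_funM; last exact: smooth_cpt_measurable.
    have := @measurable_isometry _ 1 (- (c * t + b)) _ mw.
    by under eq_fun do rewrite mul1r.
  - by apply: (ae_mono (uw t t0)) => x ->.
have bA : `|- b| <= `|b| + `|c| by rewrite normrN lerDl.
have ctA : `|- (c * t + b)| <= `|b| + `|c|.
  rewrite normrN (le_trans (ler_normD _ _))// addrC lerD2l normrM (gtr0_norm t0).
  by rewrite ler_piMr.
have [H2 _] := HC w M (- b) (- (c * t + b)) mw M0 (ae_bound_H1 hw) bA ctA.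
move: H2; under eq_fun do rewrite mulrBr.
rewrite RintB; [|exact: L2_mul_test (H1_L2 hw) (smooth_cpt_shift _ hp)
  |exact: L2_mul_test (H1_L2 hw) (smooth_cpt_shift _ hp)].
rewrite -ut -shiftE.
have -> : - (c * t + b) - - b = - (c * t) by ring.
rewrite normrN normrM (gtr0_norm t0) => H2.
have H3 : C * M * (`|c| * t) <= e / 2.
  apply: le_trans te; rewrite mulrDr mulr1 mulrA mulrC; lra.
move: H1 H2 H3; rewrite !ler_norml; lra.
Qed.

End Symmetric.

Unset Implicit Arguments.

Theorem theorem3 (R : realType) (u : R -> R -> R)
  (X : completeNormedModType R) (J : {linear X -> (R -> R^o)})
  (hu : weak_solution +oo%E u)
  (hJ : H1_embedding J)
  (hwp : locally_well_posed J)
  (hdata : exists a : X, {ae (@lebesgue_measure R), forall x, u 0 x = J a x})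
  (hsym : x_symmetric u) :
  traveling_wave u.
Proof.
have [lam [dlam sym]] := hsym.
have dl t : 0 < t -> derivable lam t 1 by move=> /dlam[].
have [w [hw uw]] := symmetric_profile hu dl sym.
have [c [b ucb]] := affine_axis hu dl hw uw.
have u0 := profile_initial hu hw ucb.
exists c, (u 0); split; first exact: (H1_at hu (lexx (0 : R))).
move=> t; rewrite le_eqVlt => /predU1P[<-|t0].
  by apply: aeW => x; rewrite mulr0 subr0.
apply: (ae_mono2 (ucb t t0) (ae_shift (c * t) u0)) => x -> ->.
by congr w; ring.
Qed.
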